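(* Consider the PARID-model with initial degrees $\{W_i\}_{i\ge1}$ and parameter $\delta$. If $\mathbb{P}(W_1>x)=x^{1-\tau_W}L(x)$, where $\tau_W\in(1,2)$ and $x\mapsto L(x)$ is slowly varying at infinity, then, for every $s<\tau_W-1$, there exists an $M$ (independent of $t$) such that, for all $t\ge1$ and all integers $k\ge1$, $$\mathbb{E}[p_{\ge k}(t)]\le Mk^{-s}.$$
   Context: PARID-model (preferential attachment with random initial degrees). Let $\{W_i\}_{i\ge1}$ be an i.i.d. sequence of positive-integer-valued random variables, with support $S_W$. Let $\delta\in\mathbb{R}$ be fixed with $\delta+\min\{x:x\in S_W\}>0$. Put $L_t=\sum_{i=1}^tW_i$. The random (multi)graph process $\{G(t)\}_{t\ge1}$ is defined as follows. $G(1)$ consists of two vertices $v_0,v_1$ with $W_1$ edges joining them. For $t\ge2$, $G(t)$ is obtained from $G(t-1)$ by adding a vertex $v_t$ and $W_t$ edges from $v_t$ to $\{v_0,\dots,v_{t-1}\}$. Conditionally on $G(t-1)$ and the initial degrees, the endpoints of these $W_t$ edges are chosen independently (with replacement), each equal to $v_i$ with probability $$\frac{d_i(t-1)+\delta}{\sum_{j=0}^{t-1}(d_j(t-1)+\delta)}=\frac{d_i(t-1)+\delta}{2L_{t-1}+t\delta},\qquad 0\le i\le t-1,$$ where $d_i(s)$ denotes the degree of $v_i$ in $G(s)$ (edges counted with multiplicity). $N_{\ge k}(t)=\sum_{i=0}^t\mathbf{1}_{\{d_i(t)\ge k\}}$ is the number of vertices of degree at least $k$ in $G(t)$, and $p_{\ge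 k}(t)=N_{\ge k}(t)/(t+1)$. The constant $M$ does not depend on $k$ either. *)

(* Defs.v *)
From HB Require Import structures.
From mathcomp Require Import all_boot all_order all_algebra finmap.
From mathcomp Require Import all_classical all_reals all_analysis.

Set Implicit Arguments.
Unset Strict Implicit.
Unset Printing Implicit Defensive.

Import Order.TTheory GRing.Theory Num.Theory.
Import numFieldNormedType.Exports.

Local Open Scope classical_set_scope.
Local Open Scope ring_scope.

(* [g i j] is the number of edges between v_i and v_j; there are no loops. *)
Definition multigraph := nat -> nat -> nat.

Definition no_edges : multigraph := fun _ _ => 0%N.

(* The vertices of a graph at time t are v_0, ..., v_t. *)
Definition degree (t : nat) (g : multigraph) (i : nat) : nat :=
  (\sum_(j < t.+1) g i j)%N.

(* Adds to [g] the vertex v_t with [n] edges, the l-th one (l < n) going from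
   v_t to v_(e l). *)
Definition attach (g : multigraph) (t n : nat) (e : nat -> nat) : multigraph :=
  fun i j => (g i j +
    \sum_(l < n) (((i == t) && (j == e l)) || ((j == t) && (i == e l))))%N.

Definition num_ge (t k : nat) (g : multigraph) : nat :=
  (\sum_(i < t.+1) (k <= degree t g i))%N.

Definition prop_ge (R : realType) (t k : nat) (g : multigraph) : R :=
  (num_ge t k g)%:R / (t.+1)%:R.

(* Here [g] stands for G(t-1). *)
Definition attach_prob (R : realType) (delta : R) (t : nat) (g : multigraph)
    (i : nat) : R :=
  ((degree t.-1 g i)%:R + delta) /
  (\sum_(j < t) ((degree t.-1 g j)%:R + delta)).

Definition cond_prob d (T : measurableType d) (R : realType)
    (P : probability T R) (A B : set T) : R :=
  fine (P (A `&` B)) / fine (P B).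

Definition mutually_independent d d' (T : measurableType d)
    (T' : measurableType d') (R : realType) (P : probability T R)
    (I : choiceType) (D : set I) (X : I -> {RV P >-> T'}) : Prop :=
  forall (J : {fset I}) (A : I -> set T'),
    [set` J] `<=` D -> (forall i, measurable (A i)) ->
    P (\bigcap_(i in [set` J]) (X i @^-1` A i)) =
    (\prod_(i <- J) P (X i @^-1` A i))%E.

Definition identically_distributed d d' (T : measurableType d)
    (T' : measurableType d') (R : realType) (P : probability T R)
    (I : Type) (D : set I) (X : I -> {RV P >-> T'}) : Prop :=
  forall i j, D i -> D j -> forall A, measurable A ->
    distribution P (X i) A = distribution P (X j) A.

Definition value_support d (T : measurableType d) (R : realType)
    (P : probability T R) (X : {RV P >-> nat}) : set nat :=
  [set n | (0 < P (X @^-1` [set n]))%E].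

Definition is_minimum (S : set nat) (m : nat) : Prop :=
  S m /\ (forall n, S n -> (m <= n)%N).

(* Measurability of [L] is not required: where it is used below, [L] is the
   product of a power function and a monotone function on (0, +oo). *)
Definition slowly_varying (R : realType) (L : R -> R) : Prop :=
  (\forall x \near +oo, 0 < L x) /\
  (forall a : R, 0 < a -> L (a * x) / L x @[x --> +oo] --> (1 : R)).

(* [W i] is used for i >= 1 only, and [E t l], the index of the endpoint of the
   l-th edge of v_t, for t >= 2 and l < W t only. *)
Record PARID d (T : measurableType d) (R : realType) (P : probability T R)
    (delta : R) (W : nat -> {RV P >-> nat}) (E : nat -> nat -> {RV P >-> nat})
    (G : nat -> T -> multigraph) : Prop := {
  parid_pos : forall i x, (1 <= i)%N -> (0 < W i x)%N;
  parid_indep : mutually_independent [set i | (1 <= i)%N] W;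
  parid_ident : identically_distributed [set i | (1 <= i)%N] W;
  parid_delta : exists2 m, is_minimum (value_support (W 1%N)) m &
                           0 < delta + m%:R;
  parid_init : forall x, G 1%N x = attach no_edges 1 (W 1%N x) (fun _ => 0%N);
  parid_step : forall t x, (2 <= t)%N ->
    G t x = attach (G t.-1 x) t (W t x) (fun l => E t l x);
  parid_endpoint : forall t l x, (2 <= t)%N -> (l < W t x)%N -> (E t l x < t)%N;
  (* All initial degrees, including those of later vertices, are conditioned
     on: by finite families (W_1, ..., W_n), with n arbitrarily large. *)
  parid_law : forall (t n : nat) (g : multigraph) (w v : nat -> nat),
    (2 <= t <= n)%N -> (forall l, (l < w t)%N -> (v l < t)%N) ->
    let H := [set x | G t.-1 x = g /\
                      forall i, (1 <= i <= n)%N -> W i x = w i] in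
    (0 < P H)%E ->
    cond_prob P [set x | forall l, (l < w t)%N -> E t l x = v l] H =
    \prod_(l < w t) attach_prob delta t g (v l)
}.

(* Main.v *)
Require Import Defs.
From HB Require Import structures.
From mathcomp Require Import all_boot all_order all_algebra finmap.
From mathcomp Require Import all_classical all_reals all_analysis.
From mathcomp Require Import measurable_realfun ring lra zify.
Import Order.TTheory GRing.Theory Num.Theory.
Import numFieldNormedType.Exports.
Local Open Scope classical_set_scope.
Local Open Scope ring_scope.

(** The proof has two halves: a supermartingale bound for the degrees given the
    initial degrees, and an estimate for sums of independent heavy-tailed
    variables. Put [alpha = tauW - 1], which is in (0, 1), and write
    [L_t = W_1 + ... + W_t].

    Given all initial degrees, a vertex v_i gains in step t on average [W_t] times
    its share [(d_i + delta) / X] in the total weight [X], whereas [X] grows by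
    [2 * W_t + delta], and [W_t + delta > 0]. The share is therefore a
    supermartingale, and the conditional mean of [d_i(t) + delta] is at most
    [(W_i + delta) * X_t / X_i], hence at most a constant times
    [W_i * L_t / L_i] (for v_0, which is born together with v_1, put i = 1). By
    Markov's inequality and [min (1, y) <= y `^ s], the conditional probability
    that [d_i(t) >= k] is [O(k `^ (- s))] times [(W_i * L_t / L_i) `^ s]
    ([pr_degree_ge_given]), and it remains to bound the average over i of the
    means of these powers, which only involve the i.i.d. initial degrees.

    With [B] the larger of [1] and [L_(i - 1)], and [D = L_t - L_i], the power is at
    most [W_i `^ s * (1 + D `^ s * B `^ (- s))], a combination of products of
    independent factors. Let [u] be the tail of [W_1] and [a] its quantile of order
    [1 / t]. Truncating at [a], Karamata's estimates show that [D `^ s] has mean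
    [O(a `^ s)] ([mean_sum_powR_le]). For [beta] between s and alpha and
    [th = s / beta < 1], Potter's bound ([potter]) gives
    [(a / B) `^ s = O(1 + (t * u B) `^ th)]. As [L_(i - 1)] is at least the maximum of
    its terms, [u B] has mean [O(1 / i)] ([mean_tail_le]). Hence
    the probability that [d_i(t) >= k] is [O(k `^ (- s) * (1 + (t / i) `^ th))]
    ([pr_degree_ge_le]), and since [th < 1] the average of this over
    i = 0, ..., t is [O(k `^ (- s))]. For [s <= 0] there is nothing to
    prove, as proportions are at most 1. *)

Set Implicit Arguments.
Unset Strict Implicit.

(** * Concavity of powers *)

Section ConcavePowers.
Variable R : realType.
Implicit Types p x y a b w : R.

(** Young's inequality for the factors [x `^ p] and [1]: a concave power stays
    below its tangent at [1]. *)
Lemma powR_le_tangent1 p x : 0 <= p <= 1 -> 0 <= x -> x `^ p <= 1 + p * (x - 1).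
Proof.
move=> /andP[p0 p1] x0.
have [->|pn0] := eqVneq p 0; first by rewrite powRr0 mul0r addr0.
have [->|pn1] := eqVneq p 1; first by rewrite powRr1// mul1r; lra.
have pp : 0 < p by rewrite lt_neqAle eq_sym pn0.
have qp : 0 < 1 - p by rewrite subr_gt0 lt_neqAle pn1.
have := @conjugate_powR R (x `^ p) 1 p^-1 (1 - p)^-1 (powR_ge0 _ _) ler01.
rewrite !invr_gt0 !invrK => /(_ pp qp) H.
have {}H := H (subrKC p 1).
move: H; rewrite -powRrM mulfV// powRr1// powR1 mulr1 mul1r => H.
apply: (le_trans H); lra.
Qed.

(** The form in which Jensen's inequality is used below: the right-hand side is
    affine in [x], so expectations can be taken termwise, and it takes the value
    [b `^ p] when [x] has expectation [b]. *)
Lemma powR_le_tangent p x b : 0 <= p <= 1 -> 0 <= x -> 0 < b ->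
  x `^ p <= p * b `^ p / b * x + (1 - p) * b `^ p.
Proof.
move=> p01 x0 b0; have -> : x = (x / b) * b by rewrite divfK ?gt_eqF.
have xb : 0 <= x / b by rewrite divr_ge0// ltW.
rewrite powRM ?(ltW b0)//.
have H : (x / b) `^ p * b `^ p <= (1 + p * (x / b - 1)) * b `^ p.
  by rewrite ler_wpM2r ?powR_ge0// powR_le_tangent1.
apply: (le_trans H); rewrite le_eqVlt; apply/orP; left; apply/eqP.
by field; rewrite gt_eqF.
Qed.

(** Each summand [u] of [z = x + y] satisfies [u / z <= (u / z) `^ p], and these
    ratios add up to [1]. *)
Lemma powR_le_add p x y : 0 < p <= 1 -> 0 <= x -> 0 <= y ->
  (x + y) `^ p <= x `^ p + y `^ p.
Proof.
move=> /andP[p0 p1] x0 y0.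
have [z0|z0] := leP (x + y) 0.
  have -> : x = 0 by lra.
  by rewrite add0r lerDr powR_ge0.
have H u : 0 <= u -> u <= x + y -> (x + y) `^ p * (u / (x + y)) <= u `^ p.
  move=> u0 ux; have [->|un0] := eqVneq u 0.
    by rewrite mul0r mulr0 powR_ge0.
  have up : 0 < u by rewrite lt_neqAle eq_sym un0.
  rewrite -[in leRHS](@divfK _ (x + y) _ u) ?gt_eqF//.
  rewrite powRM ?divr_ge0 ?(ltW z0)// mulrC ler_wpM2r ?powR_ge0//.
  by rewrite ger1_powR// divr_gt0//= ler_pdivrMr// mul1r.
have Hx := H x x0 ltac:(lra).
have Hy := H y y0 ltac:(lra).
apply: le_trans (lerD Hx Hy).
by rewrite -mulrDr -mulrDl mulfV ?mulr1// gt_eqF.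
Qed.

(** Beyond [a] the slope of the power is at most [a `^ (p - 1)]. *)
Lemma powR_le_linear p a x w : 0 <= p <= 1 -> 0 < a -> a <= x -> 0 <= w ->
  (x + w) `^ p <= x `^ p + a `^ (p - 1) * w.
Proof.
move=> /andP[p0 p1] a0 ax w0; have x0 : 0 < x by lra.
have H := @powR_le_tangent p (x + w) x _ _ x0.
have {}H := H ltac:(lra) ltac:(lra).
apply: (le_trans H).
have -> : p * x `^ p / x * (x + w) + (1 - p) * x `^ p =
    x `^ p + p * (x `^ p / x * w) by field; rewrite gt_eqF.
rewrite lerD2l.
have -> : x `^ p / x = x `^ (p - 1).
  by rewrite powRB ?(gt_eqF x0) ?implybT// powRr1// ltW.
have le1 : x `^ (p - 1) <= a `^ (p - 1).
  rewrite -[p - 1]opprB !powRN lef_pV2 ?posrE ?powR_gt0//.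
  by rewrite ge0_ler_powR ?nnegrE; lra.
have le2 : x `^ (p - 1) * w <= a `^ (p - 1) * w by rewrite ler_wpM2r.
apply: le_trans le2; rewrite ler_piMl// mulr_ge0 ?powR_ge0//.
Qed.

(** The terms [i `^ (- p)] are dominated by the increments of
    [i `^ (1 - p) / (1 - p)], by the tangent inequality; the sum telescopes. *)
Lemma sum_powRN_le p (t : nat) : 0 <= p < 1 -> (0 < t)%N ->
  \sum_(1 <= i < t.+1) (t%:R / i%:R) `^ p <= t%:R / (1 - p).
Proof.
move=> /andP[p0 p1] t0.
have q0 : 0 < 1 - p by lra.
have H n : \sum_(1 <= i < n.+1) (i%:R : R) `^ (- p) <= n%:R `^ (1 - p) / (1 - p).
  elim: n => [|n IH].
    by rewrite big_nil divr_ge0 ?powR_ge0// ltW.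
  rewrite big_nat_recr//=.
  have n1 : 0 < n.+1%:R :> R by rewrite ltr0n.
  have T := @powR_le_tangent (1 - p) n%:R n.+1%:R ltac:(lra) (ler0n _ _) n1.
  have E : n.+1%:R `^ (1 - p) / n.+1%:R = n.+1%:R `^ (- p) :> R.
    rewrite (_ : 1 - p = - p + 1) 1?addrC// powRD ?(gt_eqF n1) ?implybT//.
    by rewrite powRr1 ?ltW// mulrC mulKf ?(gt_eqF n1).
  rewrite ler_pdivlMr//; move: IH; rewrite ler_pdivlMr// => IH.
  rewrite mulrDl.
  have E2 : n%:R `^ (1 - p) <= n.+1%:R `^ (1 - p) - (1 - p) * n.+1%:R `^ (- p) :> R.
    apply: (le_trans T); rewrite -E le_eqVlt; apply/orP; left; apply/eqP.
    by rewrite -(natr1 n) in n1 *; field; rewrite gt_eqF.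
  lra.
have tp : 0 < t%:R :> R by rewrite ltr0n.
rewrite (eq_bigr (fun i => t%:R `^ p * (i%:R : R) `^ (- p))); last first.
  by move=> i _; rewrite powRM ?invr_ge0 ?ler0n// powRN -powR_inv1// -powRrM -powRN mulN1r.
rewrite -big_distrr/=.
apply: (@le_trans _ _ (t%:R `^ p * (t%:R `^ (1 - p) / (1 - p)))).
  by rewrite ler_wpM2l ?powR_ge0.
by rewrite mulrA -powRD ?(gt_eqF tp) ?implybT// subrKC powRr1// ltW.
Qed.

Lemma le_pow2_mul x y : 0 <= x -> 1 <= y -> exists N : nat, x <= 2 ^+ N.+1 * y.
Proof.
move=> x0 y1; exists (Num.bound x).
apply: (@le_trans _ _ (Num.bound x)%:R); first by rewrite ltW// archi_boundP.
apply: (@le_trans _ _ (2 ^+ (Num.bound x).+1)).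
  by rewrite -natrX ler_nat ltnW// (leq_trans (ltn_expl _ (ltnSn 1)))// leq_exp2l.
by rewrite ler_peMr ?exprn_ge0.
Qed.

End ConcavePowers.

(** * Expectations of functions of an i.i.d. sample *)

Section Sample.
Variable (R : realType) (p : nat -> R).
Local Open Scope ereal_scope.

Definition mean1 (F : nat -> \bar R) : \bar R :=
  \sum_(0 <= a <oo) (p a)%:E * F a.

(** The expectation of [f] at a list of [n] independent variables with mass
    function [p]. As an iterated series, it makes the independence of disjoint
    blocks of the list ([mean_cat]) hold by computation. *)
Fixpoint mean (n : nat) (f : seq nat -> \bar R) : \bar R :=
  if n is n'.+1 then mean1 (fun a => mean n' (fun s => f (a :: s))) else f [::].

Lemma mean_cat (m n : nat) (f : seq nat -> \bar R) :
  mean (m + n) f = mean m (fun s => mean n (fun s' => f (s ++ s'))).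
Proof.
elim: m f => [|m IH] f //=.
by apply: congr_lim; apply/funext => k; apply: eq_bigr => a _; rewrite IH.
Qed.

Hypothesis p_ge0 : forall a, (0 <= p a)%R.
Hypothesis sum_p : \sum_(0 <= a <oo) (p a)%:E = 1.

Lemma mean1_ge0 F : (forall a, 0 <= F a) -> 0 <= mean1 F.
Proof. by move=> F0; apply: nneseries_ge0 => a _ _; rewrite mule_ge0// lee_fin. Qed.

Lemma le_mean1 F G : (forall a, 0 <= F a) -> (forall a, F a <= G a) ->
  mean1 F <= mean1 G.
Proof.
move=> F0 FG; apply: lee_nneseries => [a _ _|a _].
  by rewrite mule_ge0// lee_fin.
by rewrite lee_wpmul2l// lee_fin.
Qed.

Lemma mean1D F G : (forall a, 0 <= F a) -> (forall a, 0 <= G a) ->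
  mean1 (fun a => F a + G a) = mean1 F + mean1 G.
Proof.
move=> F0 G0; rewrite -nneseriesD; last 2 first.
- by move=> a _ _; rewrite mule_ge0// lee_fin.
- by move=> a _ _; rewrite mule_ge0// lee_fin.
apply: congr_lim; apply/funext => k; apply: eq_bigr => a _.
by rewrite ge0_muleDr.
Qed.

Lemma mean1Z (c : R) F : (forall a, 0 <= F a) ->
  mean1 (fun a => c%:E * F a) = c%:E * mean1 F.
Proof.
move=> F0; rewrite -nneseriesZl; last by move=> a _; rewrite mule_ge0// lee_fin.
by apply: congr_lim; apply/funext => k; apply: eq_bigr => a _; rewrite muleCA.
Qed.

Lemma mean1_cst (c : R) : mean1 (fun=> c%:E) = c%:E.
Proof.
rewrite -[in RHS](mule1 c%:E) -sum_p -nneseriesZl; last by move=> a _; rewrite lee_fin.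
by apply: congr_lim; apply/funext => k; apply: eq_bigr => a _; rewrite muleC.
Qed.

Lemma mean_ge0 n f : (forall s, 0 <= f s) -> 0 <= mean n f.
Proof.
by elim: n f => [|n IH] f f0 //=; apply: mean1_ge0 => a; apply: IH.
Qed.

Lemma le_mean n f g : (forall s, 0 <= f s) ->
  (forall s, size s = n -> f s <= g s) -> mean n f <= mean n g.
Proof.
elim: n f g => [|n IH] f g f0 fg /=; first exact: fg.
apply: le_mean1 => a; first exact: mean_ge0.
by apply: IH => // s sn; apply: fg => /=; rewrite sn.
Qed.

Lemma meanD n f g : (forall s, 0 <= f s) -> (forall s, 0 <= g s) ->
  mean n (fun s => f s + g s) = mean n f + mean n g.
Proof.
elim: n f g => [|n IH] f g f0 g0 //=.
rewrite -mean1D => [|a|a]; [|exact: mean_ge0..].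
by apply: congr_lim; apply/funext => k; apply: eq_bigr => a _; rewrite IH.
Qed.

Lemma meanZ n (c : R) f : (forall s, 0 <= f s) ->
  mean n (fun s => c%:E * f s) = c%:E * mean n f.
Proof.
elim: n f => [|n IH] f f0 //=.
rewrite -mean1Z => [|a]; last exact: mean_ge0.
by apply: congr_lim; apply/funext => k; apply: eq_bigr => a _; rewrite IH.
Qed.

Lemma mean_cst n (c : R) : mean n (fun=> c%:E) = c%:E.
Proof.
elim: n => [|n IH] //=; rewrite -[RHS]mean1_cst.
by apply: congr_lim; apply/funext => k; apply: eq_bigr => a _; rewrite IH.
Qed.

Lemma mean1_affine_le (F : nat -> R) (b c d : R) :
  (forall a, 0 <= F a)%R -> (0 <= b)%R -> (0 <= c)%R ->
  mean1 (fun a => (F a)%:E) <= d%:E ->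
  mean1 (fun a => (b + c * F a)%:E) <= (b + c * d)%:E.
Proof.
move=> F0 b0 c0 Fd.
rewrite (_ : (fun a => _) = (fun a => b%:E + c%:E * (F a)%:E)); last first.
  by apply/funext => a; rewrite EFinD EFinM.
rewrite mean1D => [|a|a]; last 2 first.
- by rewrite lee_fin.
- by rewrite mule_ge0// lee_fin.
rewrite mean1Z ?mean1_cst => [|a]; last by rewrite lee_fin.
by rewrite EFinD EFinM leeD2l// lee_wpmul2l// lee_fin.
Qed.

Lemma mean_affine_le n (f : seq nat -> R) (b c d : R) :
  (forall s, 0 <= f s)%R -> (0 <= b)%R -> (0 <= c)%R ->
  mean n (fun s => (f s)%:E) <= d%:E ->
  mean n (fun s => (b + c * f s)%:E) <= (b + c * d)%:E.
Proof.
move=> f0 b0 c0 fd.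
rewrite (_ : (fun s => _) = (fun s => b%:E + c%:E * (f s)%:E)); last first.
  by apply/funext => a; rewrite EFinD EFinM.
rewrite meanD => [|a|a]; last 2 first.
- by rewrite lee_fin.
- by rewrite mule_ge0// lee_fin.
rewrite meanZ ?mean_cst => [|a]; last by rewrite lee_fin.
by rewrite EFinD EFinM leeD2l// lee_wpmul2l// lee_fin.
Qed.

Lemma mean_sum_le n (F : nat -> R) (d : R) : (forall a, 0 <= F a)%R ->
  mean1 (fun a => (F a)%:E) <= d%:E ->
  mean n (fun s => (\sum_(a <- s) F a)%:E) <= (n%:R * d)%:E.
Proof.
move=> F0 Fd; elim: n => [|n IH] /=; first by rewrite big_nil mul0r.
have H a : mean n (fun s => (\sum_(b <- a :: s) F b)%:E) <=
    (n%:R * d + 1 * F a)%:E.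
  rewrite (_ : (fun s => _) = (fun s => (F a + 1 * \sum_(b <- s) F b)%:E)).
    by rewrite addrC mul1r -[X in (F a + X)%R]mul1r mean_affine_le// => s; exact: sumr_ge0.
  by apply/funext => s; rewrite big_cons mul1r.
have d0 : (0 <= d)%R.
  by rewrite -lee_fin (le_trans _ Fd)// mean1_ge0// => a; rewrite lee_fin.
apply: (@le_trans _ _ (mean1 (fun a => (n%:R * d + 1 * F a)%:E))).
  by apply: le_mean1 => a //; apply: mean_ge0 => s; rewrite lee_fin sumr_ge0.
apply: (le_trans (mean1_affine_le _ _ _ Fd)) => //; first by rewrite mulr_ge0.
by rewrite lee_fin mul1r -natr1 mulrDl mul1r.
Qed.

End Sample.

(** * Regularly varying tails *)

Section Tail.
Variables (R : realType) (p : nat -> R) (u : R -> R).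
Hypothesis p_ge0 : forall a, 0 <= p a.
Hypothesis sum_p : (\sum_(0 <= a <oo) (p a)%:E = 1)%E.
Hypothesis tailE : forall x : R,
  mean1 p (fun a => ((x < a%:R)%R%:R)%:E) = (u x)%:E.
Hypothesis u_gt0 : forall x, 0 < u x.

Lemma tail_le x y : x <= y -> u y <= u x.
Proof.
move=> xy; rewrite -lee_fin -!tailE; apply: le_mean1 => // a.
rewrite lee_fin ler_nat; case: (ltP y) => // ya.
by rewrite (le_lt_trans xy ya).
Qed.

Lemma tail_le1 x : u x <= 1.
Proof.
rewrite -lee_fin -tailE -(mean1_cst p_ge0 sum_p 1); apply: le_mean1 => // a.
by rewrite lee_fin lern1 leq_b1.
Qed.

(** Regular variation enters only through the effect of doubling the argument.
    For a tail of index [- alpha] with [s < beta < alpha < 1], one may take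
    [q = 2 `^ (- beta)], [th = s / beta], and [(2 * rho)^-1] between [2^-1] and
    [2 `^ (- alpha)]; see [slowly_varying_doubling]. *)
Variables (x0 s th q rho : R).
Hypothesis x0_ge1 : 1 <= x0.
Hypothesis s01 : 0 < s < 1.
Hypothesis th01 : 0 < th < 1.
Hypothesis q01 : 0 < q < 1.
Hypothesis q_s : 2 `^ s * q < 1.
Hypothesis q_th : 2 `^ s * q `^ th <= 1.
Hypothesis rho01 : 2^-1 < rho < 1.
Hypothesis tail_double_le : forall x, x0 <= x -> u (2 * x) <= q * u x.
Hypothesis tail_double_ge : forall x, x0 <= x -> u x <= 2 * rho * u (2 * x).

(* linear arithmetic that sees the hypotheses of the section *)
Local Ltac tail_lra :=
  have := x0_ge1; have := s01; have := th01; have := q01; have := rho01;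
  do 5![move=> ?]; lra.

Let s0 : 0 <= s. Proof. by case/andP: s01 => /ltW. Qed.

Let s_mono : {in Num.nneg &, {homo (fun x : R => x `^ s) : x y / x <= y}}.
Proof. exact: ge0_ler_powR. Qed.

Let th_mono : {in Num.nneg &, {homo (fun x : R => x `^ th) : x y / x <= y}}.
Proof. by apply: ge0_ler_powR; case/andP: th01 => /ltW. Qed.

Let K1 := 2 `^ s / (1 - 2 `^ s * q).

Let K1_ge0 : 0 <= K1.
Proof. by rewrite divr_ge0 ?powR_ge0// subr_ge0 ltW. Qed.

(** Karamata's estimate for the truncated moment above [a], by induction on the
    number of dyadic blocks: moving to the next block multiplies the bound by
    [2 `^ s * q < 1], so the geometric series converges. *)
Lemma mean1_window_le N a : x0 <= a ->
  (mean1 p (fun w => (if (a < w%:R) && (w%:R <= 2 ^+ N * a)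
                      then w%:R `^ s else 0)%:E)
   <= (K1 * (a `^ s * u a))%:E)%E.
Proof.
elim: N a => [|N IH] a xa.
  rewrite (_ : (fun w => _) = fun=> 0%:E); last first.
    by apply/funext => w; rewrite expr0 mul1r; case: ltP => // aw; rewrite leNgt aw.
  by rewrite (mean1_cst p_ge0 sum_p) lee_fin; do 2!apply: mulr_ge0 => //; rewrite ?powR_ge0 ?(ltW (u_gt0 _)).
have a0 : 0 <= a by tail_lra.
pose F w := if (2 * a < w%:R) && (w%:R <= 2 ^+ N * (2 * a)) then w%:R `^ s else 0.
have F0 w : 0 <= F w by rewrite /F; case: ifP => // _; rewrite powR_ge0.
apply: (@le_trans _ _ (mean1 p (fun w => ((2 * a) `^ s)%:E * ((a < w%:R)%R%:R)%:E
     + (F w)%:E)%E)).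
  apply: le_mean1 => // w; first by rewrite lee_fin; case: ifP => // _; rewrite powR_ge0.
  rewrite -EFinM -EFinD lee_fin /F exprSr -mulrA.
  case: (ltP a) => aw /=; last first.
    by rewrite mulr0 add0r -/(F w) F0.
  rewrite mulr1; case: (ltP (2 * a)) => bw /=.
    by case: ifP; rewrite ?lerDr ?addr0 powR_ge0.
  rewrite addr0; case: ifP => _; last by rewrite powR_ge0.
  by apply: s_mono => //; rewrite ?nnegrE; tail_lra.
rewrite mean1D// => [|w]; last by rewrite mule_ge0// lee_fin ?powR_ge0.
rewrite mean1Z// tailE.
apply: le_trans (leeD2l _ (IH (2 * a) _)) _; first by tail_lra.
rewrite -EFinM -EFinD lee_fin powRM//.
have D := tail_double_le xa.
have H : K1 * (2 `^ s * a `^ s * u (2 * a)) <= K1 * (2 `^ s * a `^ s * (q * u a)).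
  by rewrite ler_wpM2l// ler_wpM2l// mulr_ge0// powR_ge0.
have E : (2 `^ s * a `^ s * u a) + K1 * (2 `^ s * a `^ s * (q * u a)) =
    K1 * (a `^ s * u a).
  by rewrite /K1; field; rewrite gt_eqF// subr_gt0.
by rewrite -E lerD2l.
Qed.


Lemma mean1_above_le a : x0 <= a ->
  (mean1 p (fun w => (if (a < w%:R)%R then w%:R `^ s else 0)%:E)
   <= (K1 * (a `^ s * u a))%:E)%E.
Proof.
move=> xa; apply: lime_le.
  apply: is_cvg_nneseries => w _ _.
  by rewrite mule_ge0 ?lee_fin//; case: ifP => // _; rewrite powR_ge0.
apply: nearW => N; apply: le_trans (mean1_window_le N xa).
apply: (@le_trans _ _ (\sum_(0 <= w < N) (p w)%:E *
    (if (a < w%:R) && (w%:R <= 2 ^+ N * a) then w%:R `^ s else 0)%:E)%E).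
  rewrite big_nat_cond [leRHS]big_nat_cond lee_sum// => w /andP[/andP[_ wN] _].
  suff -> : w%:R <= 2 ^+ N * a by rewrite andbT.
  apply: (@le_trans _ _ (2 ^+ N)).
    by rewrite -natrX ler_nat ltnW// (leq_trans wN)// ltnW// ltn_expl.
  by rewrite ler_peMr ?exprn_ge0//; tail_lra.
apply: nneseries_lim_ge => w _ _.
by rewrite mule_ge0 ?lee_fin//; case: ifP => // _; rewrite powR_ge0.
Qed.

Let K2 := Num.max (2 * rho / (1 - rho)) (2 / u (2 * x0)).

Let K2_ge0 : 0 <= K2.
Proof. by rewrite le_max; apply/orP; left; rewrite divr_ge0//; tail_lra. Qed.

(** Karamata's estimate for the truncated mean below [a]. Halving [a] multiplies
    the bound [a * u a] by at most [rho < 1]: this is where an index larger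
    than [-1] is needed. *)
Lemma mean1_below_le a : x0 <= a ->
  (mean1 p (fun w => (if (w%:R <= a)%R then w%:R else 0)%:E)
   <= (K2 * (a * u a))%:E)%E.
Proof.
move=> xa; have [N] : exists N : nat, a <= 2 ^+ N.+1 * x0.
  by apply: le_pow2_mul => //; tail_lra.
elim: N a xa => [|N IH] a xa aN.
  apply: (@le_trans _ _ a%:E).
    rewrite -(mean1_cst p_ge0 sum_p a); apply: le_mean1 => // w.
    - by rewrite lee_fin; case: ifP.
    - by rewrite lee_fin; case: ifP => // _; tail_lra.
  rewrite lee_fin mulrCA ler_peMr//; first by tail_lra.
  have H : 2 / u (2 * x0) <= K2 by rewrite le_max lexx orbT.
  have Ha : u (2 * x0) <= u a by apply: tail_le; move: aN; rewrite expr1.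
  apply: le_trans (ler_wpM2r (ltW (u_gt0 a)) H).
  rewrite mulrAC ler_pdivlMr// mul1r; have := u_gt0 a; tail_lra.
have [a2|a2] := leP a (2 * x0).
  apply: IH => //; apply: (le_trans a2); rewrite ler_wpM2r//; first by tail_lra.
  by rewrite exprS ler_peMr// exprn_ege1//; tail_lra.
have a0 : 0 <= a by tail_lra.
have xb : x0 <= a / 2 by tail_lra.
pose F w : R := if w%:R <= a / 2 then w%:R else 0.
have F0 w : 0 <= F w by rewrite /F; case: ifP.
apply: (@le_trans _ _ (mean1 p (fun w => a%:E * ((a / 2 < w%:R)%R%:R)%:E
     + (F w)%:E)%E)).
  apply: le_mean1 => // w; first by rewrite lee_fin; case: ifP.
  rewrite -EFinM -EFinD lee_fin /F.
  case: (leP w%:R (a / 2)) => wb /=.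
    by rewrite mulr0 add0r; case: ifP.
  by rewrite mulr1 addr0; case: ifP.
rewrite mean1D// => [|w]; last by rewrite mule_ge0.
rewrite mean1Z// tailE.
apply: le_trans (leeD2l _ (IH (a / 2) xb _)) _.
  by rewrite ler_pdivrMr// mulrAC -exprSr.
rewrite -EFinM -EFinD lee_fin.
have D := tail_double_ge xb; rewrite (_ : 2 * (a / 2) = a) in D; last by field.
have H1 : a * u (a / 2) <= a * (2 * rho * u a) by rewrite ler_wpM2l.
have H2 : K2 * (a / 2 * u (a / 2)) <= K2 * (a / 2 * (2 * rho * u a)).
  by rewrite ler_wpM2l// ler_wpM2l//; tail_lra.
apply: (le_trans (lerD H1 H2)).
have -> : a * (2 * rho * u a) + K2 * (a / 2 * (2 * rho * u a)) =
    (2 * rho + K2 * rho) * (a * u a) by field.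
rewrite ler_wpM2r//; first by rewrite mulr_ge0// ltW.
have H : 2 * rho / (1 - rho) <= K2 by rewrite le_max lexx.
rewrite ler_pdivrMr in H; last by tail_lra.
tail_lra.
Qed.

(** A bound for the increment of the [s]-th power of a sum already exceeding [a]
    when a term [w] is added: a large term is bounded by subadditivity, a small one by the
    slope at [a]. *)
Let psi a (w : nat) : R := if a < w%:R then w%:R `^ s else a `^ (s - 1) * w%:R.

Let psi_ge0 a w : 0 <= psi a w.
Proof. by rewrite /psi; case: ifP => _; rewrite ?mulr_ge0 ?powR_ge0. Qed.

Lemma mean1_concave_le a : x0 <= a ->
  (mean1 p (fun w => (psi a w)%:E) <= ((K1 + K2) * (a `^ s * u a))%:E)%E.
Proof.
move=> xa.
rewrite (_ : (fun w => _) = (fun w => (if (a < w%:R)%R then w%:R `^ s else 0)%:E +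
    (a `^ (s - 1))%:E * (if (w%:R <= a)%R then w%:R else 0)%:E)%E); last first.
  apply/funext => w; rewrite -EFinM -EFinD /psi.
  by case: ltP => _; rewrite ?mulr0 ?addr0 ?add0r.
rewrite mean1D// => [|w|w]; last 2 first.
- by rewrite lee_fin; case: ifP => // _; rewrite powR_ge0.
- by rewrite mule_ge0// ?lee_fin ?powR_ge0//; case: ifP.
rewrite mean1Z// => [|w]; last by rewrite lee_fin; case: ifP.
rewrite mulrDl EFinD leeD ?mean1_above_le//.
apply: le_trans (lee_wpmul2l _ (mean1_below_le xa)) _.
  by rewrite lee_fin powR_ge0.
have a0 : 0 < a by tail_lra.
rewrite -EFinM lee_fin mulrCA ler_wpM2l// mulrA ler_wpM2r ?(ltW (u_gt0 _))//.
rewrite -[X in _ * X <= _](powRr1 (ltW a0)) -powRD ?(gt_eqF a0) ?implybT//.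
by rewrite subrK.
Qed.

(** Starting the sum at [a] rather than at [0] keeps it in the range where the
    increments are controlled by [psi a]. *)
Lemma sum_powR_le a (l : seq nat) : 0 < a ->
  (a + (sumn l)%:R) `^ s <= a `^ s + \sum_(w <- l) psi a w.
Proof.
have [s1 s2] := andP s01; move=> a0.
elim: l => [|w l IH]; first by rewrite big_nil !addr0.
have -> : a + (sumn (w :: l))%:R = (a + (sumn l)%:R) + w%:R.
  by rewrite /= natrD -addrA [w%:R + _]addrC.
have al : a <= a + (sumn l)%:R by rewrite lerDl.
have H : (a + (sumn l)%:R + w%:R) `^ s <= (a + (sumn l)%:R) `^ s + psi a w.
  rewrite /psi; case: ltP => _.
    by apply: powR_le_add; rewrite ?s1 ?(ltW s2)//; lra.
  by apply: powR_le_linear; rewrite ?(ltW s1) ?(ltW s2).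
by rewrite big_cons addrCA addrC (le_trans H)// lerD2r.
Qed.

Lemma mean_sum_powR_le a n : x0 <= a ->
  (mean p n (fun l => ((sumn l)%:R `^ s)%:E)
   <= (a `^ s * (1 + (K1 + K2) * (n%:R * u a)))%:E)%E.
Proof.
move=> xa; have a0 : 0 < a by tail_lra.
apply: (@le_trans _ _ (mean p n
    (fun l => (a `^ s + 1 * \sum_(w <- l) psi a w)%:E))).
  apply: le_mean => // l _.
  rewrite lee_fin mul1r (le_trans _ (sum_powR_le l a0))//.
  by apply: s_mono; rewrite ?nnegrE ?addr_ge0 ?(ltW a0)// lerDr ltW.
apply: le_trans (mean_affine_le p_ge0 sum_p _ _ _
  (mean_sum_le p_ge0 sum_p n _ (mean1_concave_le xa))) _ => //.
- by move=> l; apply: sumr_ge0.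
- exact: powR_ge0.
rewrite lee_fin mul1r mulrDr mulr1 lerD2l le_eqVlt; apply/orP; left; apply/eqP.
by ring.
Qed.

(** Potter's bound, [(y / x) `^ s <= C * (u x / u y) `^ th]: doubling the argument
    multiplies [x `^ s * u x `^ th] by at most [2 `^ s * q `^ th <= 1]. *)
Lemma potter x y : 1 <= x -> x <= y ->
  y `^ s * u y `^ th <= 2 `^ s * x0 `^ s * (x `^ s * u x `^ th).
Proof.
have H2 z : 1 <= z -> 1 <= z `^ s.
  move=> z1; have := @s_mono 1 z; rewrite powR1; apply; rewrite ?nnegrE//.
  exact: le_trans z1.
have key z w : x0 <= z -> z <= w ->
    w `^ s * u w `^ th <= 2 `^ s * (z `^ s * u z `^ th).
  move=> xz zw; have z0 : 0 < z by tail_lra.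
  have [N] : exists N : nat, w <= 2 ^+ N.+1 * z.
    by apply: le_pow2_mul; tail_lra.
  elim: N z xz zw z0 => [|N IH] z xz zw z0 wN.
    rewrite mulrA ler_pM ?powR_ge0//.
      by rewrite -powRM ?(ltW z0)//; apply: s_mono; rewrite ?nnegrE; rewrite expr1 in wN; lra.
    by apply: th_mono; rewrite ?nnegrE ?(ltW (u_gt0 _))// tail_le.
  have [w2|w2] := leP w (2 * z).
    apply: IH => //; apply: (le_trans w2); rewrite ler_wpM2r//; first by lra.
    by rewrite exprS ler_peMr// exprn_ege1//; lra.
  apply: le_trans (IH (2 * z) _ (ltW w2) _ _) _; [lra|lra| |].
    by rewrite mulrA -exprSr.
  rewrite ler_wpM2l ?powR_ge0// powRM ?(ltW z0)//.
  rewrite [2 `^ s * _]mulrC -mulrA ler_wpM2l ?powR_ge0//.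
  have D : u (2 * z) `^ th <= q `^ th * u z `^ th.
    rewrite -powRM ?(ltW (u_gt0 _))//; last by tail_lra.
    by apply: th_mono; rewrite ?nnegrE ?mulr_ge0 ?(ltW (u_gt0 _)) ?tail_double_le//; tail_lra.
  apply: (@le_trans _ _ (2 `^ s * (q `^ th * u z `^ th))).
    by rewrite ler_wpM2l ?powR_ge0.
  by rewrite mulrA ler_piMl ?powR_ge0.
move=> x1 xy; have y1 : 1 <= y by lra.
have T : u y `^ th <= u x `^ th.
  by apply: th_mono; rewrite ?nnegrE ?(ltW (u_gt0 _))// tail_le.
have [yx|yx] := leP y x0.
  rewrite mulrA ler_pM ?powR_ge0//.
  apply: (@le_trans _ _ (1 * x0 `^ s * 1)).
    by rewrite mul1r mulr1; apply: s_mono; rewrite ?nnegrE//; tail_lra.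
  by rewrite ler_pM ?mulr_ge0 ?powR_ge0// ?ler_pM ?powR_ge0// H2//; lra.
have [xx|xx] := leP x0 x.
  apply: le_trans (key _ _ xx xy) _.
  rewrite -mulrA ler_wpM2l ?powR_ge0// ler_peMl ?mulr_ge0 ?powR_ge0//.
  exact: H2.
apply: le_trans (key _ _ (lexx _) (ltW yx)) _.
rewrite -mulrA ler_wpM2l ?powR_ge0// ler_wpM2l ?powR_ge0//.
apply: (@le_trans _ _ (1 * u x `^ th)).
  by rewrite mul1r; apply: th_mono; rewrite ?nnegrE ?(ltW (u_gt0 _))// tail_le// ltW.
by rewrite ler_wpM2r ?powR_ge0// H2.
Qed.


Let K3 := Num.max (2 * rho) (u x0)^-1.

Let K3_ge1 : 1 <= K3.
Proof. by rewrite le_max; apply/orP; left; tail_lra. Qed.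

(** An approximate quantile of order [1 / n]: the first term of
    [x0], [2 * x0], [4 * x0], ... whose tail is at most [1 / n]; the term before
    it shows that the tail there is not much smaller. *)
Let quantile n : (0 < n)%N ->
  exists a, [/\ x0 <= a, n%:R * u a <= 1 & 1 <= K3 * (n%:R * u a)].
Proof.
move=> n0; have np : 0 < n%:R :> R by rewrite ltr0n.
have uq N : u (2 ^+ N * x0) <= q ^+ N.
  elim: N => [|N IH]; first by rewrite !expr0 tail_le1.
  rewrite !exprS -mulrA (le_trans (tail_double_le _))//.
    by rewrite ler_peMl// ?exprn_ege1//; tail_lra.
  by rewrite ler_wpM2l//; tail_lra.
(* Bernoulli's inequality, in a form that shows that q ^+ N tends to 0 *)
have bern N : q ^+ N * (1 + N%:R * (1 - q)) <= 1.
  elim: N => [|N IH]; first by rewrite expr0 mul0r addr0 mul1r.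
  apply: le_trans IH; rewrite exprSr -mulrA ler_wpM2l ?exprn_ge0//; first by tail_lra.
  rewrite -natr1 -subr_ge0.
  have -> : 1 + N%:R * (1 - q) - q * (1 + (N%:R + 1) * (1 - q)) =
    (N%:R + 1) * (1 - q) ^+ 2 by ring.
  by rewrite mulr_ge0 ?sqr_ge0.
have ex : exists N : nat, n%:R * u (2 ^+ N * x0) <= 1.
  exists (Num.bound (n%:R / (1 - q))); set N := Num.bound _.
  have H : n%:R / (1 - q) < N%:R.
    by rewrite archi_boundP// divr_ge0//; tail_lra.
  rewrite ltr_pdivrMr in H; last by tail_lra.
  apply: le_trans (bern N); rewrite mulrC ler_pM// ?(ltW (u_gt0 _))//; lra.
case: (ex_minnP ex) => -[|N] HN Nmin.
  exists x0; rewrite expr0 mul1r in HN; split => //.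
  apply: (@le_trans _ _ ((u x0)^-1 * (n%:R * u x0))).
    rewrite mulrCA mulVf ?gt_eqF// mulr1 ler1n//.
  by rewrite ler_wpM2r ?mulr_ge0 ?(ltW (u_gt0 _))// le_max lexx orbT.
have xN : x0 <= 2 ^+ N * x0 by rewrite ler_peMl// ?exprn_ege1//; tail_lra.
exists (2 ^+ N.+1 * x0); split => //.
  by rewrite ler_peMl// ?exprn_ege1//; tail_lra.
have H1 : 1 < n%:R * u (2 ^+ N * x0).
  by rewrite ltNge; apply/negP => /Nmin; rewrite ltnn.
have H2 := tail_double_ge xN.
rewrite mulrA -exprS in H2.
apply: le_trans (ltW H1) _.
apply: (@le_trans _ _ (2 * rho * (n%:R * u (2 ^+ N.+1 * x0)))).
  by rewrite [leRHS]mulrCA ler_wpM2l.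
by rewrite ler_wpM2r ?mulr_ge0 ?(ltW (u_gt0 _))// le_max lexx.
Qed.

(** The tail transform of a variable is stochastically dominated by the uniform
    law on the unit interval. *)
Let mean1_tail_le v : 0 < v -> v <= 1 ->
  (mean1 p (fun w => ((v < u w%:R)%R%:R)%:E) <= (1 - v)%:E)%E.
Proof.
move=> v0 v1.
have ex : exists w : nat, u w%:R <= v.
  have [a [xa na _]] := @quantile (Num.bound v^-1).+1 (ltn0Sn _).
  exists (Num.bound a); apply: (@le_trans _ _ (u a)).
    by apply: tail_le; rewrite ltW// archi_boundP//; tail_lra.
  have H : v^-1 < (Num.bound v^-1)%:R by rewrite archi_boundP// invr_ge0 ltW.
  have H' : v^-1 * u a <= v^-1 * v.
    rewrite mulVf ?gt_eqF//; apply: le_trans na.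
    by rewrite ler_wpM2r ?(ltW (u_gt0 _))// -natr1; lra.
  by rewrite ler_pM2l ?invr_gt0 in H'.
case: (ex_minnP ex) => -[|w] uw wmin.
  rewrite (_ : (fun w => _) = fun=> 0%:E); last first.
    apply/funext => w; rewrite ltNge (le_trans _ uw)//.
    by apply: tail_le; rewrite ler_nat.
  by rewrite mean1_cst// lee_fin subr_ge0.
have vu : v < u w%:R by rewrite ltNge; apply/negP => /wmin; rewrite ltnn.
have : (mean1 p (fun b => ((v < u b%:R)%R%:R)%:E) + (u w%:R)%:E <= 1%:E)%E.
  rewrite -tailE -mean1D// -(mean1_cst p_ge0 sum_p 1).
  apply: le_mean1 => // b; first by rewrite adde_ge0// lee_fin.
  rewrite -EFinD lee_fin ltr_nat.
  have [bw|bw] := leqP b w; first by rewrite addr0; case: ltP.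
  rewrite ltNge (le_trans _ uw) ?add0r//.
  by apply: tail_le; rewrite ler_nat.
move=> H; apply: (@le_trans _ _ (1 - u w%:R)%:E).
  by rewrite EFinB leeBrDr.
by rewrite lee_fin; lra.
Qed.

(** One more term: [u (x + w) <= min (u x) (u w)], and with probability at least
    [u x / 2] the second argument is at most half of the first. *)
Let mean1_tail_add_le x : 0 <= x ->
  (mean1 p (fun w => (u (x + w%:R))%:E) <= (u x - (u x) ^+ 2 / 4)%:E)%E.
Proof.
move=> xge0; set v := u x; have v0 : 0 < v by exact: u_gt0.
have v1 : v <= 1 by exact: tail_le1.
apply: (@le_trans _ _ (mean1 p (fun w => (v / 2 + v / 2 *
    ((v / 2 < u w%:R)%R%:R))%:E))).
  apply: le_mean1 => // w; first by rewrite lee_fin (ltW (u_gt0 _)).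
  rewrite lee_fin; case: ltP => [_|h].
    by rewrite mulr1 -splitr; apply: tail_le; rewrite lerDl.
  rewrite mulr0 addr0 (le_trans _ h)//.
  by apply: tail_le; rewrite lerDr.
have v2 : 0 < v / 2 by lra.
have H := mean1_tail_le v2 ltac:(lra).
apply: (le_trans (mean1_affine_le p_ge0 sum_p _ (ltW v2) (ltW v2) H)) => //.
rewrite lee_fin le_eqVlt; apply/orP; left; apply/eqP; by field.
Qed.

(** A sum of [n] terms exceeds their maximum, whose tail transform has mean at
    most [1 / (n + 1)]. A new term lowers the mean [m] at least to [m - m ^+ 2 / 4],
    and this recursion already forces the order [1 / n]. *)
Lemma mean_tail_le n :
  (mean p n (fun l => (u (sumn l)%:R)%:E) <= (4 / (n%:R + 4))%:E)%E.
Proof.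
elim: n => [|n IH]; first by rewrite /= lee_fin add0r divff// tail_le1.
rewrite -addn1 mean_cat /=.
(* v - v ^+ 2 / 4 is replaced by its tangent at the value b expected for v *)
set b : R := 4 / (n%:R + 4).
have n4 : 0 < n%:R + 4 :> R by have := ler0n R n; lra.
have b1 : b <= 1 by rewrite ler_pdivrMr// mul1r lerDr.
have b0 : 0 < b by rewrite divr_gt0.
apply: (@le_trans _ _ (mean p n (fun l => (b ^+ 2 / 4 + (1 - b / 2) * u (sumn l)%:R)%:E))).
  apply: le_mean => // l; first by apply: mean1_ge0 => // w; rewrite lee_fin ltW.
  move=> _.
  rewrite (_ : (fun w => _) = (fun w => (u ((sumn l)%:R + w%:R))%:E)); last first.
    by apply/funext => w; rewrite sumn_cat /= addn0 natrD.
  apply: le_trans (mean1_tail_add_le _) _ => //.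
  rewrite lee_fin; set v := u _; rewrite -subr_ge0.
  have -> : b ^+ 2 / 4 + (1 - b / 2) * v - (v - v ^+ 2 / 4) = (v - b) ^+ 2 / 4 by field.
  by rewrite divr_ge0// sqr_ge0.
apply: le_trans (mean_affine_le p_ge0 sum_p _ _ _ IH) _.
- by move=> l; rewrite ltW.
- by rewrite divr_ge0// sqr_ge0.
- lra.
rewrite lee_fin -/b -subr_ge0 natrD.
have n5 : 0 < n%:R + 1 + 4 :> R by have := ler0n R n; lra.
have -> : 4 / (n%:R + 1 + 4) - (b ^+ 2 / 4 + (1 - b / 2) * b) =
   4 / ((n%:R + 4) ^+ 2 * (n%:R + 1 + 4)).
  by rewrite /b; field; rewrite !gt_eqF.
by rewrite divr_ge0// mulr_ge0 ?exprn_ge0 ?ltW.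
Qed.

Let mean1_moment_le :
  (mean1 p (fun w => (w%:R `^ s)%:E) <= (x0 `^ s + K1 * (x0 `^ s * u x0))%:E)%E.
Proof.
apply: (@le_trans _ _ (mean1 p (fun w => (x0 `^ s + 1 *
    (if x0 < w%:R then w%:R `^ s else 0))%:E))).
  apply: le_mean1 => // w.
  rewrite lee_fin mul1r; case: ltP => wx; first by rewrite lerDr powR_ge0.
  by rewrite addr0; apply: s_mono; rewrite ?nnegrE//; tail_lra.
apply: (le_trans (mean1_affine_le p_ge0 sum_p _ _ _ (mean1_above_le (lexx x0)))) => //.
- by move=> w; case: ifP => // _; rewrite powR_ge0.
- exact: powR_ge0.
by rewrite mul1r.
Qed.

(** Here [l1], [w], [l2] are the initial degrees before, at and after the birth of
    a vertex, [l2] having at most [t] entries. With [a] the quantile of order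
    [1 / t], the [s]-th moment of [sumn l2] is [O(a `^ s)], and Potter's bound
    gives [(a / b) `^ s = O(1 + (t * u b) `^ th)] for [b] the larger of [1] and
    [sumn l1]. The mean of [u b] is [O(1 / m.+1)], and Jensen's inequality carries
    this through the power [th < 1]. *)
Lemma mean_degree_moment_le : exists2 C : R, 0 <= C &
  forall m n t : nat, (0 < t)%N -> (n <= t)%N ->
  (mean p m (fun l1 => mean1 p (fun w => mean p n (fun l2 =>
     (w%:R `^ s * (1 + (sumn l2)%:R `^ s *
        (Num.max 1 (sumn l1)%:R) `^ (- s)))%:E)))
   <= (C * (1 + (t%:R / m.+1%:R) `^ th))%:E)%E.
Proof.
pose K := K1 + K2; have K0 : 0 <= K by rewrite addr_ge0.
pose Ms := x0 `^ s + K1 * (x0 `^ s * u x0).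
have Ms0 : 0 <= Ms.
  apply: addr_ge0; first exact: powR_ge0.
  by rewrite mulr_ge0// mulr_ge0 ?powR_ge0// ltW.
pose K4 := 1 + 2 `^ s * x0 `^ s.
have K4_ge1 : 1 <= K4 by rewrite lerDl mulr_ge0 ?powR_ge0.
pose A := Ms * (1 + K) * K4.
have A0 : 0 <= A.
  by apply: mulr_ge0; [apply: mulr_ge0 => //; apply: addr_ge0|exact: le_trans K4_ge1].
exists (Ms + A * (1 + 4 * K3)).
  rewrite addr_ge0// mulr_ge0//; have := K3_ge1; lra.
move=> m n t t0 nt.
have tp : 0 < t%:R :> R by rewrite ltr0n.
have [a [xa ta at1]] := quantile t0.
have a1 : 1 <= a by tail_lra.
have a0 : 0 < a by lra.
pose c := K3 * (t%:R * (4 / (m%:R + 4))).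
have K3p : 0 < K3 by have := K3_ge1; lra.
have m4 : 0 < m%:R + 4 :> R by have := ler0n R m; lra.
have c0 : 0 < c by rewrite /c mulr_gt0// mulr_gt0// divr_gt0.
have thb : 0 <= th <= 1 by case/andP: th01 => h1 h2; rewrite !ltW.
(* Potter's bound when b < a; when a <= b the left-hand side is at most 1 *)
have key b : 1 <= b -> a `^ s * b `^ (- s) <= K4 * (1 + (K3 * t%:R * u b) `^ th).
  move=> b1; have b0 : 0 < b by lra.
  have bs : 0 < b `^ s by rewrite powR_gt0.
  rewrite powRN ler_pdivrMr//.
  have [ab|ab] := leP a b.
    have H : a `^ s <= b `^ s by apply: s_mono; rewrite ?nnegrE// ltW.
    apply: (le_trans H); rewrite ler_peMl ?(ltW bs)//.
    apply: (le_trans K4_ge1); rewrite ler_peMr ?lerDl ?powR_ge0//.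
    exact: le_trans K4_ge1.
  have P := potter b1 (ltW ab).
  have T : 1 <= (K3 * t%:R * u a) `^ th.
    have := @th_mono 1 (K3 * t%:R * u a); rewrite powR1; apply; rewrite ?nnegrE//.
      by rewrite !mulr_ge0 ?ltW.
    by rewrite -mulrA.
  apply: (@le_trans _ _ (a `^ s * (K3 * t%:R * u a) `^ th)).
    by rewrite ler_peMr ?powR_ge0.
  have kt : 0 <= K3 * t%:R by rewrite mulr_ge0 ?ltW.
  rewrite !(powRM _ kt) ?(ltW (u_gt0 _))// mulrCA.
  apply: le_trans (ler_wpM2l (powR_ge0 _ _) P) _.
  have h : 0 <= (K3 * t%:R) `^ th * u b `^ th by rewrite mulr_ge0 ?powR_ge0.
  have h2 : 0 <= 2 `^ s * x0 `^ s by rewrite mulr_ge0 ?powR_ge0.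
  set X := 2 `^ s * x0 `^ s in h2 P *.
  have -> : (K3 * t%:R) `^ th * (X * (b `^ s * u b `^ th)) =
    X * ((K3 * t%:R) `^ th * u b `^ th) * b `^ s by ring.
  by rewrite ler_wpM2r ?(ltW bs)// ler_pM// ?lerDr ?lerDl ?ler01.
pose d := a `^ s * (1 + K).
have d0 : 0 <= d by rewrite mulr_ge0 ?powR_ge0// addr_ge0.
have D : (mean p n (fun l2 => ((sumn l2)%:R `^ s)%:E) <= d%:E)%E.
  apply: le_trans (mean_sum_powR_le n xa) _.
  rewrite lee_fin ler_wpM2l ?powR_ge0// lerD2l ler_piMr//.
  by rewrite (le_trans _ ta)// ler_wpM2r ?(ltW (u_gt0 _))// ler_nat.
pose B l : R := Num.max 1 (sumn l)%:R.
have B1 l : 1 <= B l by rewrite le_max lexx.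
have inner l1 w : (mean p n (fun l2 => (w%:R `^ s * (1 + (sumn l2)%:R `^ s *
        (B l1) `^ (- s)))%:E) <= (0 + (1 + d * B l1 `^ (- s)) * w%:R `^ s)%:E)%E.
  rewrite (_ : (fun l2 => _) = (fun l2 => (w%:R `^ s +
     w%:R `^ s * (B l1) `^ (- s) * (sumn l2)%:R `^ s)%:E)); last first.
    by apply/funext => l2; congr EFin; ring.
  apply: le_trans (mean_affine_le p_ge0 sum_p _ _ _ D) _ => //.
    by rewrite mulr_ge0 ?powR_ge0.
  by rewrite lee_fin le_eqVlt; apply/orP; left; apply/eqP; ring.
have middle l1 : (mean1 p (fun w => mean p n (fun l2 =>
     (w%:R `^ s * (1 + (sumn l2)%:R `^ s * (B l1) `^ (- s)))%:E)) <=
     (Ms + A + A * (1 - th) * c `^ th + A * th * c `^ th / c * (K3 * t%:R) *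
       u (sumn l1)%:R)%:E)%E.
  apply: (@le_trans _ _ (mean1 p (fun w => (0 + (1 + d * B l1 `^ (- s)) * w%:R `^ s)%:E))).
    apply: le_mean1 => // w; apply: mean_ge0 => // l2.
    by rewrite lee_fin mulr_ge0 ?addr_ge0 ?mulr_ge0 ?powR_ge0.
  apply: le_trans (mean1_affine_le p_ge0 sum_p _ _ _ mean1_moment_le) _ => //.
    by rewrite ler_wpDr// mulr_ge0// powR_ge0.
  rewrite lee_fin add0r -/Ms mulrDl mul1r -!addrA !lerD2l.
  have -> : d * B l1 `^ (- s) * Ms = Ms * (1 + K) * (a `^ s * B l1 `^ (- s)).
    by rewrite /d; ring.
  have MK : 0 <= Ms * (1 + K) by apply: mulr_ge0 => //; apply: addr_ge0.
  apply: le_trans (ler_wpM2l MK (key _ (B1 l1))) _.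
  rewrite mulrA -/A mulrDr mulr1 lerD2l.
  have kt : 0 <= K3 * t%:R by rewrite mulr_ge0 ?ltW.
  have uB : u (B l1) <= u (sumn l1)%:R by apply: tail_le; rewrite le_max lexx orbT.
  have T : (K3 * t%:R * u (B l1)) `^ th <=
     th * c `^ th / c * (K3 * t%:R * u (sumn l1)%:R) + (1 - th) * c `^ th.
    apply: le_trans (powR_le_tangent thb _ c0).
      by apply: th_mono; rewrite ?nnegrE ?mulr_ge0 ?(ltW (u_gt0 _)) ?ler_wpM2l ?(ltW tp) ?(ltW K3p).
    by rewrite mulr_ge0 ?(ltW (u_gt0 _)).
  apply: le_trans (ler_wpM2l A0 T) _.
  by rewrite le_eqVlt; apply/orP; left; apply/eqP; ring.
apply: (@le_trans _ _ (mean p m (fun l1 => (Ms + A + A * (1 - th) * c `^ th +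
    A * th * c `^ th / c * (K3 * t%:R) * u (sumn l1)%:R)%:E))).
  apply: (le_mean p_ge0) => l1; last by move=> _; exact: middle.
  by apply: mean1_ge0 => // w; apply: mean_ge0 => // l2.
have t1 : 0 <= 1 - th by tail_lra.
have t2 : 0 <= th by tail_lra.
apply: le_trans (mean_affine_le p_ge0 sum_p _ _ _ (mean_tail_le m)) _.
- by move=> l; rewrite ltW.
- have tc : 0 <= (1 - th) * c `^ th by rewrite mulr_ge0 ?powR_ge0.
  by rewrite -mulrA; apply: addr_ge0; [apply: addr_ge0|apply: mulr_ge0].
- apply: mulr_ge0; last by rewrite mulr_ge0 ?ltW.
  apply: divr_ge0; last exact: ltW.
  by apply: mulr_ge0; [apply: mulr_ge0|exact: powR_ge0].
rewrite lee_fin.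
have -> : Ms + A + A * (1 - th) * c `^ th + A * th * c `^ th / c * (K3 * t%:R) *
    (4 / (m%:R + 4)) = Ms + A * (1 + c `^ th).
  have -> : A * th * c `^ th / c * (K3 * t%:R) * (4 / (m%:R + 4)) =
     A * th * c `^ th.
    have E : K3 * t%:R * (4 / (m%:R + 4)) = c by rewrite /c -mulrA.
    by rewrite -mulrA E divfK// lt0r_neq0.
  by ring.
set y := (t%:R / m.+1%:R) `^ th.
have y0 : 0 <= y by rewrite powR_ge0.
have m1 : 0 < m.+1%:R :> R by rewrite ltr0n.
have cy : c `^ th <= 4 * K3 * y.
  apply: (@le_trans _ _ ((4 * K3 * (t%:R / m.+1%:R)) `^ th)).
    apply: th_mono; rewrite ?nnegrE ?(ltW c0)//.
      by rewrite !mulr_ge0 ?invr_ge0 ?ltW.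
    rewrite /c (_ : K3 * _ = 4 * K3 * (t%:R / (m%:R + 4))); last by ring.
    rewrite ler_wpM2l ?mulr_ge0 ?(ltW K3p)// ler_wpM2l ?(ltW tp)//.
    by rewrite lef_pV2 ?posrE// -natr1 lerD2l; lra.
  rewrite powRM ?mulr_ge0 ?invr_ge0 ?(ltW tp) ?(ltW m1) ?(ltW K3p)//.
  rewrite ler_wpM2r// ler1_powR//; last by case/andP: thb.
  by have := K3_ge1; lra.
have Z : A * (1 + c `^ th) <= A * ((1 + 4 * K3) * (1 + y)).
  rewrite ler_wpM2l// mulrDl mul1r -addrA lerD2l.
  have : 0 <= K3 by lra.
  lra.
have : Ms <= Ms * (1 + y) by rewrite ler_peMr// lerDl.
lra.
Qed.

End Tail.

(** * Degrees in growing multigraphs *)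

Section Graphs.
Local Open Scope nat_scope.
Implicit Types (g : multigraph) (w e : nat -> nat).

(** Degrees at time [t] count only the edges among v_0, ..., v_t, so a graph has
    to be known to have no other edges before a vertex is attached. *)
Definition vertices_upto (t : nat) g : Prop :=
  forall i j, (t < i) || (t < j) -> g i j = 0.

Lemma vertices_upto_attach t g n e : vertices_upto t.-1 g ->
  (forall l, l < n -> e l < t) -> vertices_upto t (attach g t n e).
Proof.
move=> sg et i j tij; rewrite /attach sg ?big1//.
  by move=> [l ln] _ /=; have h := et l ln; apply/eqP; rewrite eqb0; lia.
by case/orP: tij => ti; rewrite (leq_ltn_trans (leq_pred t) ti) ?orbT.
Qed.

Lemma sum_eq_ord (t k : nat) : \sum_(j < t) (j == k :> nat) = (k < t).
Proof.
have [kt|kt] := ltnP k t.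
  rewrite (bigD1 (Ordinal kt))//= eqxx big1// => j.
  by rewrite -val_eqE /= => /negbTE ->.
by rewrite big1// => j _; rewrite ltn_eqF// (leq_trans (ltn_ord j)).
Qed.

Lemma degree_attach_old t g n e i : 0 < t -> vertices_upto t.-1 g ->
  (forall l, l < n -> e l < t) -> i < t ->
  degree t (attach g t n e) i = degree t.-1 g i + \sum_(l < n) (i == e l).
Proof.
case: t => // t _ sg et it; rewrite /degree /attach big_split /=.
congr addn.
  by rewrite big_ord_recr /= (sg i t.+1) ?addn0//= ltnSn orbT.
rewrite exchange_big /=; apply: eq_bigr => l _.
rewrite (eq_bigr (fun j : 'I_t.+2 => (i == e l) * (j == t.+1 :> nat))).
  by rewrite -big_distrr /= sum_eq_ord ltnSn muln1.
by move=> j _; rewrite (ltn_eqF it) /=; case: (j == _ :> nat); case: (i == _).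
Qed.

Lemma degree_attach_new t g n e : 0 < t -> vertices_upto t.-1 g ->
  (forall l, l < n -> e l < t) -> degree t (attach g t n e) t = n.
Proof.
case: t => // t _ sg et; rewrite /degree /attach big_split /= big1; last first.
  by move=> j _; rewrite sg //= ltnSn.
rewrite add0n exchange_big /= (eq_bigr (fun=> 1)).
  by rewrite sum1_card card_ord.
move=> [l ln] _ /=; have el := et l ln.
rewrite (eq_bigr (fun j : 'I_t.+2 => nat_of_bool (j == e l :> nat))).
  by rewrite sum_eq_ord ltnS ltnW.
by move=> j _; rewrite eqxx /= [t.+1 == _]eq_sym (ltn_eqF el) andbF orbF.
Qed.

Lemma sum_degree_attach t g n e : 0 < t -> vertices_upto t.-1 g ->
  (forall l, l < n -> e l < t) ->
  \sum_(i < t.+1) degree t (attach g t n e) i =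
  \sum_(i < t) degree t.-1 g i + n.*2.
Proof.
move=> t0 sg et; rewrite big_ord_recr /= degree_attach_new//.
rewrite (eq_bigr (fun i : 'I_t => degree t.-1 g i + \sum_(l < n) (i == e l :> nat))).
  rewrite big_split /= -addnA; congr addn.
  rewrite [X in X + n]exchange_big /= (eq_bigr (fun=> 1)).
    by rewrite sum1_card card_ord addnn.
  by move=> [l ln] _ /=; rewrite sum_eq_ord et.
by move=> i _; rewrite degree_attach_old.
Qed.

(** Endpoints are functions on [nat] in the model; finite functions make the
    possible choices summable. *)
Definition endpoints (n t : nat) (e : {ffun 'I_n -> 'I_t}) : nat -> nat :=
  fun l => if insub l is Some l' then val (e l') else 0.

Lemma endpoints_ord n t (e : {ffun 'I_n -> 'I_t}) (l : 'I_n) : endpoints e l = e l.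
Proof. by rewrite /endpoints valK. Qed.

Lemma endpoints_lt n t (e : {ffun 'I_n -> 'I_t}) l : l < n -> endpoints e l < t.
Proof. by move=> ln; rewrite -[l]/(nat_of_ord (Ordinal ln)) endpoints_ord. Qed.

Lemma eq_attach g t n e e' : (forall l, l < n -> e l = e' l) ->
  attach g t n e = attach g t n e'.
Proof.
move=> ee'; apply/funext => i; apply/funext => j; rewrite /attach; congr addn.
by apply: eq_bigr => l _; rewrite ee'.
Qed.

(** The graphs possible at time [n.+1], given the initial degrees [w]. Finiteness
    of this list is what turns conditional expectations into finite sums. *)
Fixpoint graphs (w : nat -> nat) (n : nat) : seq multigraph :=
  if n is n'.+1 then
    [seq attach g n'.+2 (w n'.+2) (endpoints f) |
      g <- graphs w n', f <- enum {ffun 'I_(w n'.+2) -> 'I_n'.+2}]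
  else [:: attach no_edges 1 (w 1) (fun=> 0)].

Lemma graphs_ind w (Q : nat -> multigraph -> Prop) :
  (forall e, (forall l, l < w 1 -> e l < 1) -> Q 0 (attach no_edges 1 (w 1) e)) ->
  (forall n g e, g \in graphs w n -> Q n g -> (forall l, l < w n.+2 -> e l < n.+2) ->
     Q n.+1 (attach g n.+2 (w n.+2) e)) ->
  forall n g, g \in graphs w n -> Q n g.
Proof.
move=> Q0 QS; elim=> [|n IH] g /=; first by rewrite inE => /eqP ->; apply: Q0.
case/allpairsP => -[g' e] /= [g'n _ ->]; apply: QS => //; first exact: IH.
by move=> l; apply: endpoints_lt.
Qed.

Lemma vertices_upto_graphs w n g : g \in graphs w n -> vertices_upto n.+1 g.
Proof.
by move: n g; apply: graphs_ind => [e|n g e _ IH] he; apply: vertices_upto_attach.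
Qed.

Lemma sum_degree_graphs w n g : g \in graphs w n ->
  \sum_(i < n.+2) degree n.+1 g i = (\sum_(1 <= i < n.+2) w i).*2.
Proof.
move: n g; apply: graphs_ind => [e|n g e gn IH] he.
  rewrite sum_degree_attach// big_nat1 big1// => i _.
  by rewrite /degree big1.
rewrite sum_degree_attach//=; last exact: vertices_upto_graphs gn.
by rewrite IH [in RHS]big_nat_recr//= doubleD.
Qed.

(** Vertex v_i is born at time [maxn i 1], since v_0 and v_1 are born together. *)
Lemma degree_graphs_birth w i g : g \in graphs w i.-1 ->
  degree (maxn i 1) g i = w (maxn i 1).
Proof.
move=> gi; case: i gi => [|i] /=.
  rewrite inE => /eqP ->; rewrite degree_attach_old// /degree big1// add0n.
  by rewrite (eq_bigr (fun=> 1)) ?sum1_card ?card_ord.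
have -> : maxn i.+1 1 = i.+1 by apply/maxn_idPl.
case: i => [|i] /=.
  by rewrite inE => /eqP ->; rewrite degree_attach_new.
case/allpairsP => -[g' e] /= [g'n _ ->]; rewrite degree_attach_new//.
  exact: vertices_upto_graphs g'n.
by move=> l; apply: endpoints_lt.
Qed.

Lemma degree_graphs_ge w n g i : g \in graphs w n -> i <= n.+1 ->
  w (maxn i 1) <= degree n.+1 g i.
Proof.
move: n g; apply: graphs_ind => [e|n g e gn IH] he.
  case: i => [|[|i]]// _; last by rewrite degree_attach_new.
  rewrite degree_attach_old// /degree big1// add0n.
  rewrite (eq_bigr (fun=> 1)) ?sum1_card ?card_ord// => -[l ln] _ /=.
  by have := he l ln; case: (e l).
rewrite leq_eqVlt => /orP[/eqP ->|].
  rewrite degree_attach_new//; exact: vertices_upto_graphs gn.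
rewrite ltnS => it; rewrite degree_attach_old//.
  by rewrite (leq_trans (IH it))// leq_addr.
exact: vertices_upto_graphs gn.
Qed.

End Graphs.

(** With [m] independent draws from the distribution [p], the expected number of
    draws equal to [i] is [m * p i]; the sum is over all outcomes. *)
Lemma sum_prod_ffun (R : realType) (m k : nat) (p : 'I_k -> R) (a : R) (i : 'I_k) :
  \sum_j p j = 1 ->
  \sum_(e : {ffun 'I_m -> 'I_k}) (\prod_l p (e l)) *
     (a + (\sum_l (i == e l))%N%:R) = a + m%:R * p i.
Proof.
move=> p1.
rewrite (eq_bigr (fun e : {ffun 'I_m -> 'I_k} => a * (\prod_l p (e l)) +
    \sum_l0 \prod_l (p (e l) * (if l == l0 then (i == e l)%:R else 1)))); last first.
  move=> e _; rewrite mulrDr mulrC natr_sum big_distrr /=; congr (_ + _).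
  apply: eq_bigr => l0 _; rewrite big_split /=; congr (_ * _).
  by rewrite (bigD1 l0)//= eqxx big1 ?mulr1// => l /negbTE ->.
rewrite big_split /= -big_distrr /= -(bigA_distr_bigA (fun _ => p)) /=.
rewrite big1 ?mulr1 //; congr (_ + _).
rewrite exchange_big /=.
rewrite (eq_bigr (fun=> p i)); first by rewrite sumr_const card_ord mulr_natl.
move=> l0 _.
rewrite -(bigA_distr_bigA (fun l j => p j * (if l == l0 then (i == j)%:R else 1))) /=.
rewrite (bigD1 l0)//= eqxx [X in _ * X]big1 ?mulr1; last first.
  by move=> l /negbTE ->; rewrite -[RHS]p1; apply: eq_bigr => j _; rewrite mulr1.
rewrite (bigD1 i)//= eqxx mulr1 big1 ?addr0// => j /negbTE.
by rewrite eq_sym => ->; rewrite mulr0.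
Qed.

(** * The degree of a vertex given all initial degrees *)

Section DiscreteMaps.
Context d (T : measurableType d) (R : realType) (P : probability T R).

(** Measurability of maps to [nat], by fibres: this form is closed under sums whose
    length is itself random ([nat_measurable_dep]), as in [attach]. *)
Definition nat_measurable (X : T -> nat) : Prop :=
  forall n, measurable [set x | X x = n].

Lemma nat_measurable_cst n : nat_measurable (fun=> n).
Proof.
move=> m; have [->|nm] := eqVneq n m.
  by rewrite (_ : [set _ | _] = setT)//; apply/seteqP; split.
rewrite (_ : [set _ | _] = set0)//; apply/seteqP; split => // x /= h.
by rewrite h eqxx in nm.
Qed.

Lemma nat_measurable_RV (X : {RV P >-> nat}) : nat_measurable X.
Proof. by move=> n; exact: (@measurable_funPTI _ _ _ _ X [set n] I). Qed.

Lemma nat_measurable_dep (X : T -> nat) (Z : nat -> T -> nat) :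
  nat_measurable X -> (forall m, nat_measurable (Z m)) ->
  nat_measurable (fun x => Z (X x) x).
Proof.
move=> mX mZ n.
rewrite (_ : [set _ | _] = \bigcup_m ([set x | X x = m] `&` [set x | Z m x = n])).
  by apply: bigcup_measurable => m _; apply: measurableI; [apply: mX|apply: mZ].
apply/seteqP; split => x /=; first by move=> h; exists (X x).
by case=> m _ [/= <-].
Qed.

Lemma nat_measurable_comp (f : nat -> nat) X :
  nat_measurable X -> nat_measurable (fun x => f (X x)).
Proof.
by move=> mX; apply: (nat_measurable_dep (Z := fun m _ => f m)) => // m;
  apply: nat_measurable_cst.
Qed.

Lemma nat_measurable_add X Y : nat_measurable X -> nat_measurable Y ->
  nat_measurable (fun x => X x + Y x)%N.
Proof.
move=> mX mY; apply: (nat_measurable_dep (Z := fun m x => m + Y x)%N) => // m.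
exact: nat_measurable_comp.
Qed.

Lemma nat_measurable_sum n (F : nat -> T -> nat) :
  (forall l, nat_measurable (F l)) -> nat_measurable (fun x => \sum_(l < n) F l x)%N.
Proof.
move=> mF; elim: n => [|n IH].
  rewrite (_ : (fun _ => _) = fun=> 0%N); first exact: nat_measurable_cst.
  by apply/funext => x; rewrite big_ord0.
rewrite (_ : (fun _ => _) = fun x => (\sum_(l < n) F l x + F n x)%N).
  exact: nat_measurable_add.
by apply/funext => x; rewrite big_ord_recr.
Qed.

Lemma nat_measurable_ge X k : nat_measurable X -> measurable [set x | (k <= X x)%N].
Proof.
move=> mX; rewrite (_ : [set _ | _] = \bigcup_(n in [set n | (k <= n)%N]) [set x | X x = n]).
  by apply: bigcup_measurable => n _; apply: mX.
apply/seteqP; split => x /=; first by move=> h; exists (X x).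
by case=> m /= h ->.
Qed.

Lemma measurable_nat_forall (Q : nat -> Prop) (F : nat -> T -> nat) v :
  (forall i, nat_measurable (F i)) ->
  measurable [set x | forall i, Q i -> F i x = v i].
Proof.
move=> mF.
rewrite (_ : [set _ | _] = \bigcap_(i in Q) [set x | F i x = v i]).
  by apply: bigcap_measurableType => i _; apply: mF.
by apply/seteqP; split => x /= h i; apply: h.
Qed.

Definition pr (A : set T) : R := fine (P A).

Lemma prE A : measurable A -> P A = (pr A)%:E.
Proof. by move=> mA; rewrite /pr fineK// fin_num_measure. Qed.

Lemma pr_ge0 A : 0 <= pr A.
Proof. by rewrite /pr fine_ge0. Qed.

Lemma pr_le A B : measurable A -> measurable B -> A `<=` B -> pr A <= pr B.
Proof.
by move=> mA mB AB; rewrite -lee_fin -!prE// le_measure ?inE.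
Qed.

Lemma pr_partition (B : set T) (I : choiceType) (X : T -> I) (D : seq I) :
  uniq D -> (forall x, B x -> X x \in D) ->
  (forall c, measurable (B `&` [set x | X x = c])) ->
  pr B = \sum_(c <- D) pr (B `&` [set x | X x = c]).
Proof.
move=> uD BD mB.
have mem (s : seq I) : measurable (B `&` [set x | X x \in s]) /\
    (uniq s -> P (B `&` [set x | X x \in s]) =
      (\sum_(c <- s) pr (B `&` [set x | X x = c]))%:E).
  elim: s => [|c s [mIH IH]].
    rewrite (_ : B `&` _ = set0); first by rewrite big_nil measure0.
    by apply/seteqP; split => // x [].
  have E : B `&` [set x | X x \in c :: s] =
      (B `&` [set x | X x = c]) `|` (B `&` [set x | X x \in s]).
    apply/seteqP; split => x /=.
      by case=> Bx; rewrite inE => /orP[/eqP|]; [left|right].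
    by case=> -[Bx h]; split => //; rewrite inE h ?eqxx ?orbT.
  rewrite E; split; first exact: measurableU.
  rewrite cons_uniq => /andP[cs us].
  have PU : P ((B `&` [set x | X x = c]) `|` (B `&` [set x | X x \in s])) =
      (P (B `&` [set x | X x = c]) + P (B `&` [set x | X x \in s]))%E.
    apply: measureU => //; apply/seteqP; split => // x [/= [_ h] [_]].
    by rewrite h (negbTE cs).
  by rewrite PU (IH us) (prE (mB c)) big_cons EFinD.
have [_ /(_ uD)] := mem D.
rewrite (_ : B `&` [set x | X x \in D] = B); first by rewrite /pr => ->.
by apply/seteqP; split => [x []//|x Bx]; split => //=; apply: BD.
Qed.

(** Expectation of [phi] at a finitely valued map, computed from a finer one. *)
Lemma pr_mean_comp (B : set T) (I J : choiceType) (X : T -> I) (Y : T -> J)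
    (h : J -> I) (DX : seq I) (DY : seq J) (phi : I -> R) :
  uniq DX -> uniq DY -> (forall y, y \in DY -> h y \in DX) ->
  (forall x, B x -> Y x \in DY) -> (forall x, B x -> X x = h (Y x)) ->
  (forall c, measurable (B `&` [set x | X x = c])) ->
  (forall y, measurable (B `&` [set x | Y x = y])) ->
  \sum_(c <- DX) phi c * pr (B `&` [set x | X x = c]) =
  \sum_(y <- DY) phi (h y) * pr (B `&` [set x | Y x = y]).
Proof.
move=> uX uY hD YD XY mX mY.
have E c y : B `&` [set x | X x = c] `&` [set x | Y x = y] =
    if h y == c then B `&` [set x | Y x = y] else set0.
  apply/seteqP; split => [x [[Bx /= Xc] Yy]|x].
    by rewrite -Yy -XY// Xc eqxx.
  by case: eqP => // <- [Bx Yy]; split => //; split => //=; rewrite XY// Yy.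
under eq_bigr => c _.
  rewrite (pr_partition uY _ (B := B `&` [set x | X x = c]) (X := Y)); last 2 first.
  - by move=> x [Bx _]; apply: YD.
  - by move=> y; rewrite E; case: ifP => // _; apply: measurable0.
  rewrite big_distrr /=; over.
rewrite exchange_big /= !big_seq; apply: eq_bigr => y yD.
rewrite (bigD1_seq (h y)) ?hD//= E eqxx big1 ?addr0// => c hc.
by rewrite E eq_sym (negbTE hc) /pr measure0 mulr0.
Qed.

End DiscreteMaps.

Section Model.
Context d (T : measurableType d) (R : realType) (P : probability T R).
Variables (delta : R) (W : nat -> {RV P >-> nat}) (E : nat -> nat -> {RV P >-> nat}).
Variable (G : nat -> T -> multigraph).
Hypothesis M : PARID delta W E G.

Lemma nat_measurable_graph n i j : nat_measurable (fun x => G n.+1 x i j).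
Proof.
elim: n => [|n IH].
  rewrite (_ : (fun x => _) =
      (fun x => attach no_edges 1 (W 1%N x) (fun=> 0%N) i j)); last first.
    by apply/funext => x; rewrite (parid_init M).
  apply: (nat_measurable_dep (X := W 1%N)
    (Z := fun m _ => attach no_edges 1 m (fun=> 0%N) i j)).
    exact: nat_measurable_RV.
  by move=> m; exact: nat_measurable_cst.
rewrite (_ : (fun x => _) =
    (fun x => attach (G n.+1 x) n.+2 (W n.+2 x) (fun l => E n.+2 l x) i j)); last first.
  by apply/funext => x; rewrite (parid_step M).
rewrite /attach; apply: nat_measurable_add => //.
apply: (nat_measurable_dep (X := W n.+2) (Z := fun m x => \sum_(l < m)
  (((i == n.+2) && (j == E n.+2 l x)) || ((j == n.+2) && (i == E n.+2 l x))))%N).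
  exact: nat_measurable_RV.
move=> m; apply: (nat_measurable_sum m (F := fun l x => nat_of_bool
  (((i == n.+2) && (j == E n.+2 l x)) || ((j == n.+2) && (i == E n.+2 l x))))) => l.
exact: (nat_measurable_comp
  (fun v => nat_of_bool (((i == n.+2) && (j == v)) || ((j == n.+2) && (i == v))))
  (nat_measurable_RV (E n.+2 l))).
Qed.

Lemma nat_measurable_degree n i : nat_measurable (fun x => degree n.+1 (G n.+1 x) i).
Proof.
by apply: (nat_measurable_sum n.+2 (F := fun j x => G n.+1 x i j)) => j;
  apply: nat_measurable_graph.
Qed.

Lemma measurable_graph_eq n g : measurable [set x | G n.+1 x = g].
Proof.
rewrite (_ : [set _ | _] =
    \bigcap_(i in setT) \bigcap_(j in setT) [set x | G n.+1 x i j = g i j]).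
  do 2![apply: bigcap_measurableType => ? _]; exact: nat_measurable_graph.
apply/seteqP; split => x /=; first by move=> <- i _ j _.
move=> h; apply/funext => i; apply/funext => j; exact: (h i I j I).
Qed.

Variables (m0 : nat).
Hypothesis m0_gt0 : (0 < m0)%N.
Hypothesis m0_delta : 0 < delta + m0%:R.

(** Everything in this part takes place on the event [H] that the first [N]
    initial degrees have the prescribed values [w]; [m0] stands for the
    smallest possible initial degree. *)
Section Conditioned.
Variables (N : nat) (w : nat -> nat).
Hypothesis w_ge : forall i, (1 <= i <= N)%N -> (m0 <= w i)%N.

Let H := [set x | forall i, (1 <= i <= N)%N -> W i x = w i].

Lemma measurable_initial_degrees : measurable H.
Proof. by apply: measurable_nat_forall => i; apply: nat_measurable_RV. Qed.

Let mH := measurable_initial_degrees.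

(** The sum of the attachment weights [degree + delta] of v_0, ..., v_t, which the
    initial degrees determine ([sum_degree_delta]). *)
Definition total_weight (t : nat) : R :=
  ((\sum_(1 <= i < t.+1) w i).*2)%:R + t.+1%:R * delta.

Let w_delta i : (1 <= i <= N)%N -> 0 < (w i)%:R + delta.
Proof.
move=> iN; have : m0%:R <= (w i)%:R :> R by rewrite ler_nat w_ge.
by have := m0_delta; lra.
Qed.

Lemma total_weightS t : total_weight t.+1 = total_weight t + 2 * (w t.+1)%:R + delta.
Proof.
rewrite /total_weight big_nat_recr//= doubleD natrD -!muln2 !natrM -(natr1 t.+1).
ring.
Qed.

Lemma total_weight_gt0 t : (1 <= t <= N)%N -> 0 < total_weight t.
Proof.
elim: t => // t IH tN; rewrite total_weightS.
have w1 := w_delta tN; have w0 : 0 <= (w t.+1)%:R :> R by [].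
case: t IH tN w1 w0 => [|t] IH tN w1 w0.
  by rewrite /total_weight big_nil double0 mul1r add0r; lra.
by have := IH ltac:(lia); lra.
Qed.

Lemma sum_degree_delta n g : g \in graphs w n ->
  \sum_(i < n.+2) ((degree n.+1 g i)%:R + delta) = total_weight n.+1.
Proof.
move=> gn; rewrite big_split /= -natr_sum (sum_degree_graphs gn).
by rewrite sumr_const card_ord -[delta *+ _]mulr_natl.
Qed.

(** The endpoints of v_(n+2) as a finite function; on [H] these are always in
    range, so [inord] only serves to give the function its type. *)
Let restricted (n : nat) (x : T) : {ffun 'I_(w n.+2) -> 'I_n.+2} :=
  [ffun l => inord (E n.+2 (nat_of_ord l) x)].

Let graph_step n x : H x -> (n.+2 <= N)%N ->
  G n.+2 x = attach (G n.+1 x) n.+2 (w n.+2) (endpoints (restricted n x)).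
Proof.
move=> Hx nN; rewrite (parid_step M)//= Hx//; apply: eq_attach => l lw.
rewrite -[l in endpoints _ l]/(nat_of_ord (Ordinal lw)) endpoints_ord ffunE /=.
by rewrite inordK// (parid_endpoint M)// Hx.
Qed.

Lemma graph_in_graphs n x : H x -> (n.+1 <= N)%N -> G n.+1 x \in graphs w n.
Proof.
move=> Hx; elim: n => [|n IH] nN.
  by rewrite /= inE (parid_init M) Hx.
rewrite graph_step//=; apply/allpairsP.
by exists (G n.+1 x, restricted n x); rewrite /= IH ?mem_enum//; lia.
Qed.

Let restricted_eq n x (f : {ffun 'I_(w n.+2) -> 'I_n.+2}) : H x -> (n.+2 <= N)%N ->
  restricted n x = f <-> (forall l, (l < w n.+2)%N -> E n.+2 l x = endpoints f l).
Proof.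
move=> Hx nN; split => [<- l lw|h].
  rewrite -[l in endpoints _ l]/(nat_of_ord (Ordinal lw)) endpoints_ord ffunE /=.
  by rewrite inordK// (parid_endpoint M)// Hx.
apply/ffunP => l; rewrite ffunE h// endpoints_ord; apply: val_inj => /=.
by rewrite inordK.
Qed.

Let at_graph n g := H `&` [set x | G n.+1 x = g].

Let m_at_graph n g : measurable (at_graph n g).
Proof. by apply: measurableI => //; apply: measurable_graph_eq. Qed.

Let m_step n g f : (n.+2 <= N)%N ->
  measurable (at_graph n g `&` [set x | restricted n x = f]).
Proof.
move=> nN; rewrite (_ : _ `&` _ = at_graph n g `&`
     [set x | forall l, (l < w n.+2)%N -> E n.+2 l x = endpoints f l]).
  by apply: measurableI => //; apply: measurable_nat_forall => l; apply: nat_measurable_RV.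
apply/seteqP; split => x [[Hx gx] h]; split => //=.
  exact/(restricted_eq f Hx nN).
exact/(restricted_eq f Hx nN).
Qed.

(** On null events, where nothing is known about the conditional law, both sides
    vanish. *)
Let pr_step n g f : (n.+2 <= N)%N ->
  pr P (at_graph n g `&` [set x | restricted n x = f]) =
  pr P (at_graph n g) * \prod_(l < w n.+2) attach_prob delta n.+2 g (f l).
Proof.
move=> nN.
have sub : at_graph n g `&` [set x | restricted n x = f] =
    [set x | forall l, (l < w n.+2)%N -> E n.+2 l x = endpoints f l] `&` at_graph n g.
  apply/seteqP; split => x [] => [[Hx gx] h|h [Hx gx]]; split => //=.
    exact/(restricted_eq f Hx nN).
  exact/(restricted_eq f Hx nN).
have [p0|p0] := eqVneq (pr P (at_graph n g)) 0.
  rewrite p0 mul0r; apply/eqP; rewrite eq_le pr_ge0 andbT -p0.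
  by apply: pr_le => //; exact: m_step.
have Eat : [set x | G n.+2.-1 x = g /\
    forall i, (1 <= i <= N)%N -> W i x = w i] = at_graph n g.
  by apply/seteqP; split => x [].
have := parid_law M (t := n.+2) (n := N) (g := g) (w := w) (v := endpoints f).
rewrite Eat /cond_prob => /(_ _ _ _).
move=> /(_ nN (fun l => @endpoints_lt _ _ f l)) law.
have Ppos : (0 < P (at_graph n g))%E.
  by rewrite prE// lte_fin lt_neqAle eq_sym p0 pr_ge0.
have := law Ppos; rewrite -sub -/(pr P _) -/(pr P _) => /(congr1 (fun y => y * pr P (at_graph n g))).
rewrite divfK// => ->; rewrite mulrC; congr (_ * _).
by apply: eq_bigr => l _; rewrite endpoints_ord.
Qed.

(** The integral over [H] of [phi] at the graph at time [n.+1]. *)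
Let mass n (phi : multigraph -> R) : R :=
  \sum_(g <- undup (graphs w n)) phi g * pr P (at_graph n g).

(** The conditional law of the endpoints acts on functions of the graph as a
    transition kernel. *)
Let mass_step n phi : (n.+2 <= N)%N -> mass n.+1 phi =
  mass n (fun g => \sum_(f : {ffun 'I_(w n.+2) -> 'I_n.+2})
    (\prod_(l < w n.+2) attach_prob delta n.+2 g (f l)) *
    phi (attach g n.+2 (w n.+2) (endpoints f))).
Proof.
move=> nN.
pose Y x := (G n.+1 x, restricted n x).
pose D := [seq (g, f) | g <- undup (graphs w n),
                        f <- enum {ffun 'I_(w n.+2) -> 'I_n.+2}].
have YE y : H `&` [set x | Y x = y] =
    at_graph n y.1 `&` [set x | restricted n x = y.2].
  apply/seteqP; split => [x [Hx /= <-]|x [[Hx /= gx] fx]] //=.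
  by split => //=; rewrite /Y gx fx; case: y {gx fx}.
pose h (y : multigraph * {ffun 'I_(w n.+2) -> 'I_n.+2}) : multigraph :=
  attach y.1 n.+2 (w n.+2) (endpoints y.2).
rewrite /mass (@pr_mean_comp _ _ _ P H _ _ _ Y h _ D phi); last first.
- by move=> y; rewrite YE; exact: m_step.
- by move=> g; exact: m_at_graph.
- by move=> x Hx; exact: graph_step.
- move=> x Hx; apply/allpairsP; exists (Y x); split => //=.
    by rewrite mem_undup graph_in_graphs// ltnW.
  by rewrite mem_enum.
- move=> y /allpairsP[[g f] /= [gD _ ->]] /=; rewrite mem_undup.
  by apply/allpairsP; exists (g, f); rewrite /= -(mem_undup (graphs _ _)) gD mem_enum.
- by rewrite allpairs_uniq ?undup_uniq ?enum_uniq// => -[? ?] [? ?] _ _ [-> ->].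
- exact: undup_uniq.
rewrite /D big_allpairs_dep /=; apply: eq_bigr => g _.
rewrite big_distrl /= big_enum /=; apply: eq_bigr => f _.
rewrite YE /= pr_step// /h /= mulrCA [RHS]mulrC; congr (_ * _).
exact: mulrC.
Qed.

(** Each of the [w n.+2] edges of the new vertex reaches v_i with probability
    [(degree + delta) / total_weight], so its expected weight is multiplied by a
    deterministic factor. *)
Let mass_degree_step n i : (n.+2 <= N)%N -> (i <= n.+1)%N ->
  mass n.+1 (fun g => (degree n.+2 g i)%:R + delta) =
  mass n (fun g => (degree n.+1 g i)%:R + delta) *
    (1 + (w n.+2)%:R / total_weight n.+1).
Proof.
move=> nN iN; rewrite mass_step// /mass big_distrl /= !big_seq.
apply: eq_bigr => g; rewrite mem_undup => gn.
have X0 : total_weight n.+1 != 0 by rewrite gt_eqF// total_weight_gt0//; lia.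
rewrite mulrAC; congr (_ * _).
pose p (j : 'I_n.+2) : R := attach_prob delta n.+2 g j.
have p1 : \sum_j p j = 1.
  by rewrite -big_distrl /= (sum_degree_delta gn) divff.
have S := sum_prod_ffun (w n.+2) ((degree n.+1 g i)%:R + delta) (inord i) p1.
rewrite (eq_bigr (fun f : {ffun 'I_(w n.+2) -> 'I_n.+2} => (\prod_l p (f l)) *
   ((degree n.+1 g i)%:R + delta + (\sum_l (inord i == f l))%N%:R))); last first.
  move=> f _; congr (_ * _).
  rewrite /= (@degree_attach_old n.+2)//=; last 2 first.
  - exact: vertices_upto_graphs gn.
  - by move=> l; apply: endpoints_lt.
  rewrite natrD addrAC; congr (_ + _); congr (_%:R); apply: eq_bigr => l _.
  by rewrite endpoints_ord -val_eqE /= inordK.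
rewrite S /p /attach_prob (sum_degree_delta gn) inordK//=.
by field.
Qed.

Let mass_degree_birth i : (i <= N)%N -> (1 <= N)%N ->
  mass i.-1 (fun g => (degree i.-1.+1 g i)%:R + delta) =
  pr P H * ((w (maxn i 1))%:R + delta).
Proof.
move=> iN N1; rewrite (pr_partition P (B := H) (X := G i.-1.+1)
    (undup_uniq (graphs w i.-1))); last 2 first.
- by move=> x Hx; rewrite mem_undup graph_in_graphs//; lia.
- by move=> g; exact: m_at_graph.
rewrite big_distrl /= /mass !big_seq; apply: eq_bigr => g; rewrite mem_undup => gi.
rewrite mulrC; congr (_ * (_%:R + _)).
rewrite -(degree_graphs_birth gi); congr (degree _ g i).
by case: i {iN gi} => // i; apply/esym/maxn_idPl.
Qed.

(** The share of v_i in the total weight is a supermartingale: its weight grows by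
    the factor [1 + w / X] with [X] the total weight, while [X] itself becomes
    [X + 2 * w + delta >= X + w], because [w + delta] is nonnegative. *)
Let mass_degree_le i n : (i <= n.+1)%N -> (n.+1 <= N)%N ->
  mass n (fun g => (degree n.+1 g i)%:R + delta) * total_weight (maxn i 1) <=
  pr P H * ((w (maxn i 1))%:R + delta) * total_weight n.+1.
Proof.
elim: n => [|n IH] iN nN.
  have i0 : i.-1 = 0%N by lia.
  have := mass_degree_birth (i := i) ltac:(lia) ltac:(lia); rewrite i0 => ->.
  by have -> : maxn i 1 = 1%N by lia.
move: iN; rewrite leq_eqVlt => /orP[/eqP iE|iN].
  have := mass_degree_birth (i := i) ltac:(lia) ltac:(lia); rewrite iE /= => ->.
  by have -> : maxn n.+2 1 = n.+2 by lia.
have {}IH := IH iN ltac:(lia).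
have X0 : 0 < total_weight n.+1 by rewrite total_weight_gt0//; lia.
rewrite mass_degree_step// mulrAC.
have W0 : 0 <= 1 + (w n.+2)%:R / total_weight n.+1 :> R.
  by rewrite addr_ge0// divr_ge0// ltW.
apply: (le_trans (ler_wpM2r W0 IH)).
rewrite -[leLHS]mulrA ler_wpM2l//.
  by rewrite mulr_ge0 ?pr_ge0// ltW// w_delta//; lia.
have -> : total_weight n.+1 * (1 + (w n.+2)%:R / total_weight n.+1) =
    total_weight n.+1 + (w n.+2)%:R by field; rewrite gt_eqF.
have wd : 0 < (w n.+2)%:R + delta by apply: w_delta; lia.
by rewrite [leRHS]total_weightS; lra.
Qed.

(** Adding [delta] to a number not smaller than [m0] multiplies it by at least
    this positive constant. *)
Definition kappa : R := (m0%:R + delta) / (m0%:R + `|delta|).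

Let m0d : 0 < m0%:R + delta.
Proof. by have := m0_delta; lra. Qed.

Let m0ad : 0 < m0%:R + `|delta|.
Proof. by rewrite ltr_pwDl// ltr0n. Qed.

Lemma kappa_gt0 : 0 < kappa.
Proof. by rewrite divr_gt0// ltr0n. Qed.

Let kappa_le x : m0%:R <= x -> kappa * x <= x + delta.
Proof.
move=> mx; rewrite /kappa mulrAC ler_pdivrMr//.
have := m0d; have := mx; have [d0|d0] := leP 0 delta => h1 h2.
  by rewrite (ger0_norm d0) [leLHS]mulrC; apply: ler_wpM2r; lra.
rewrite (ltr0_norm d0) -subr_ge0.
have -> : (x + delta) * (m0%:R - delta) - (m0%:R + delta) * x =
  (- delta) * ((x - m0%:R) + (x + delta)) by ring.
by rewrite mulr_ge0//; lra.
Qed.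

Let markov_degree i k n : N = n.+1 -> (i <= N)%N ->
  pr P (H `&` [set x | (k <= degree N (G N x) i)%N]) * (kappa * k%:R) <=
  mass n (fun g => (degree n.+1 g i)%:R + delta).
Proof.
move=> NE iN; rewrite NE.
set A := H `&` _.
have AE g : A `&` [set x | G n.+1 x = g] =
    if (k <= degree n.+1 g i)%N then at_graph n g else set0.
  apply/seteqP; split => [x [[Hx /= kx] gx]|x].
    by rewrite -gx kx.
  by case: ifP => // kg [Hx /= gx]; split => //; split => //=; rewrite gx.
rewrite (pr_partition P (B := A) (X := G n.+1) (undup_uniq (graphs w n))); last 2 first.
- by move=> x [Hx _]; rewrite mem_undup graph_in_graphs// NE.
- by move=> g; rewrite AE; case: ifP => // _; exact: m_at_graph.
rewrite big_distrl /= /mass !big_seq; apply: ler_sum => g; rewrite mem_undup => gn.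
have dm : m0%:R <= (degree n.+1 g i)%:R :> R.
  rewrite ler_nat (leq_trans _ (degree_graphs_ge gn _)) -?NE//.
  by apply: w_ge; lia.
rewrite AE; case: ifP => kg; last first.
  rewrite /pr measure0 mul0r mulr_ge0 ?fine_ge0//.
  by have := m0d; lra.
rewrite mulrC ler_wpM2r ?pr_ge0//; apply: le_trans (kappa_le dm).
by rewrite ler_wpM2l ?(ltW kappa_gt0)// ler_nat.
Qed.

Definition edge_count (t : nat) : R := (\sum_(1 <= j < t.+1) w j)%N%:R.

Let ell_ge t : (t <= N)%N -> t%:R * m0%:R <= edge_count t.
Proof.
rewrite /edge_count -natrM ler_nat; elim: t => // t IH tN.
by rewrite big_nat_recr//= mulSnr leq_add ?IH ?w_ge//; lia.
Qed.

Let total_weight_le t : (1 <= t <= N)%N -> total_weight t <= 2 * (1 + `|delta|) * edge_count t.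
Proof.
move=> tN; have lt := ell_ge (t := t) ltac:(lia).
have t1 : 1 <= t%:R :> R by rewrite ler1n; lia.
have m1 : 1 <= m0%:R :> R by rewrite ler1n.
have tl : t%:R <= edge_count t by apply: le_trans lt; rewrite ler_peMr.
rewrite /total_weight -muln2 natrM -/(edge_count t) -(natr1 t).
have H1 : (t%:R + 1) * delta <= (t%:R + 1) * `|delta| by rewrite ler_wpM2l// ?addr_ge0// ler_norm.
have H2 : (t%:R + 1) * `|delta| <= 2 * edge_count t * `|delta|.
  by rewrite ler_wpM2r//; lra.
lra.
Qed.

Let total_weight_ge t : (1 <= t <= N)%N -> 2 * kappa * edge_count t <= total_weight t.
Proof.
move=> tN; have lt := ell_ge (t := t) ltac:(lia).
have t1 : 1 <= t%:R :> R by rewrite ler1n; lia.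
have m1 : 1 <= m0%:R :> R by rewrite ler1n.
rewrite /total_weight -muln2 natrM -/(edge_count t) -(natr1 t).
have K : kappa * (2 * edge_count t / (t%:R + 1)) <= 2 * edge_count t / (t%:R + 1) + delta.
  apply: kappa_le; rewrite ler_pdivlMr; last by lra.
  apply: (@le_trans _ _ (2 * (t%:R * m0%:R))); last by lra.
  have : m0%:R <= t%:R * m0%:R :> R by rewrite ler_peMl.
  lra.
have t0 : 0 < t%:R + 1 :> R by lra.
have := ler_wpM2r (ltW t0) K.
have -> : kappa * (2 * edge_count t / (t%:R + 1)) * (t%:R + 1) = 2 * kappa * edge_count t.
  by field; rewrite gt_eqF.
have -> : (2 * edge_count t / (t%:R + 1) + delta) * (t%:R + 1) =
   edge_count t * 2 + (t%:R + 1) * delta by field; rewrite gt_eqF.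
by [].
Qed.

(** Markov's inequality for the weight of v_i, interpolated with the trivial bound
    [1] by [min (1, y) <= y `^ s]. *)
Lemma pr_degree_ge_given i k s : (1 <= N)%N -> (i <= N)%N -> (1 <= k)%N ->
  0 <= s <= 1 ->
  pr P (H `&` [set x | (k <= degree N (G N x) i)%N]) <=
  pr P H * (((1 + `|delta|) / kappa) ^+ 2 *
     ((w (maxn i 1))%:R * (edge_count N / edge_count (maxn i 1))) / k%:R) `^ s.
Proof.
move=> N1 iN k1 s01; set A := H `&` _; set j := maxn i 1; set y := _ / _.
have jN : (1 <= j <= N)%N by rewrite /j; lia.
have NN : (1 <= N <= N)%N by rewrite N1 leqnn.
have PN : N.-1.+1 = N by rewrite prednK.
have mA : measurable A.
  apply: measurableI => //; case: (N) N1 => // n _.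
  exact: nat_measurable_ge (nat_measurable_degree _ _).
have k0 : 0 < k%:R :> R by rewrite ltr0n.
have m1 : 1 <= m0%:R :> R by rewrite ler1n.
have ellp t : (1 <= t <= N)%N -> 0 < edge_count t.
  case/andP=> t0 tN; apply: lt_le_trans (ell_ge tN).
  by rewrite mulr_gt0 ?ltr0n.
have wj1 : 1 <= (w j)%:R :> R by apply: (le_trans m1); rewrite ler_nat w_ge.
have kap := kappa_gt0.
have a0 : 0 < 1 + `|delta| by rewrite ltr_pwDl.
have y0 : 0 < y.
  rewrite /y divr_gt0// mulr_gt0 ?exprn_gt0 ?divr_gt0// mulr_gt0 ?divr_gt0 ?ellp//; lra.
have Ay : pr P A <= pr P H * y.
  have M1 := markov_degree k (esym PN) iN; rewrite PN in M1.
  have M2 := @mass_degree_le i N.-1; rewrite PN -/j in M2.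
  have {}M2 := M2 iN (leqnn N).
  have Xj := total_weight_ge jN; have XN := total_weight_le NN.
  have Xj0 := total_weight_gt0 jN.
  have B : pr P A * (kappa * k%:R) * total_weight j <=
     pr P H * ((w j)%:R + delta) * total_weight N.
    by apply: le_trans M2; rewrite ler_wpM2r// ltW.
  have B1 : pr P A * (kappa * k%:R) * (2 * kappa * edge_count j) <=
      pr P A * (kappa * k%:R) * total_weight j.
    by rewrite ler_wpM2l// mulr_ge0 ?pr_ge0// mulr_ge0 ?ltW.
  have wd : (w j)%:R + delta <= (w j)%:R * (1 + `|delta|).
    rewrite mulrDr mulr1 lerD2l (le_trans (ler_norm _))//.
    by rewrite ler_peMl.
  have B2 : pr P H * ((w j)%:R + delta) * total_weight N <=
    pr P H * ((w j)%:R * (1 + `|delta|)) * (2 * (1 + `|delta|) * edge_count N).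
    apply: ler_pM => //.
    - by rewrite mulr_ge0 ?pr_ge0// ltW// w_delta.
    - by rewrite ltW// total_weight_gt0.
    - by rewrite ler_wpM2l ?pr_ge0.
  have B3 := le_trans (le_trans B1 B) B2.
  have lj := ellp _ jN.
  have -> : pr P H * y = pr P H * ((w j)%:R * (1 + `|delta|)) *
      (2 * (1 + `|delta|) * edge_count N) / ((kappa * k%:R) * (2 * kappa * edge_count j)).
    by rewrite /y; field; rewrite !gt_eqF.
  rewrite ler_pdivlMr; last first.
    by apply: mulr_gt0; [exact: mulr_gt0|apply: mulr_gt0 => //; exact: mulr_gt0].
  by rewrite [leLHS]mulrA.
have [y1|y1] := leP 1 y.
  apply: (@le_trans _ _ (pr P H * 1)).
    by rewrite mulr1; apply: pr_le => // x [].
  rewrite ler_wpM2l ?pr_ge0//.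
  have : 1 `^ s <= y `^ s.
    by case/andP: s01 => s0 _; apply: ge0_ler_powR => //; rewrite nnegrE// ltW.
  by rewrite powR1.
apply: (le_trans Ay); rewrite ler_wpM2l ?pr_ge0// ger1_powR//.
  by rewrite y0 ltW.
by case/andP: s01.
Qed.

End Conditioned.
End Model.

(** * Summing over the initial degrees *)

Section Linking.
Context d (T : measurableType d) (R : realType) (P : probability T R).
Variable (W : nat -> {RV P >-> nat}).
Hypothesis indep : mutually_independent [set i | (1 <= i)%N] W.
Hypothesis ident : identically_distributed [set i | (1 <= i)%N] W.

Definition law (a : nat) : R := pr P (W 1%N @^-1` [set a]).

Lemma law_ge0 a : 0 <= law a. Proof. exact: pr_ge0. Qed.

Let mW i a : measurable (W i @^-1` [set a]).
Proof. exact: nat_measurable_RV. Qed.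

Lemma mean1_law (Q : set nat) :
  mean1 law (fun a => ((a \in Q)%:R : R)%:E) = P (W 1%N @^-1` Q).
Proof.
rewrite (_ : W 1%N @^-1` Q = \bigcup_a (W 1%N @^-1` (if a \in Q then [set a] else set0))).
  rewrite measure_semi_bigcup //=; last 3 first.
  - by move=> a; case: ifP => // _; rewrite preimage_set0.
  - move=> a b _ _ [x []] /=; case: ifP => // _ <-; case: ifP => // _ <- //.
  - apply: bigcup_measurable => a _; case: ifP => // _; by rewrite preimage_set0.
  apply: congr_lim; apply/funext => k; apply: eq_bigr => a _.
  case: ifP => _; first by rewrite mule1 -prE.
  by rewrite mule0 preimage_set0 measure0.
apply/seteqP; split => x /=.
  by move=> Qx; exists (W 1%N x) => //=; rewrite mem_set.
by case=> a _ /=; case: ifP => // /set_mem Qa ->.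
Qed.

Lemma sum_law : (\sum_(0 <= a <oo) (law a)%:E = 1)%E.
Proof.
rewrite -(probability_setT P) -[setT](preimage_setT (W 1%N)) -mean1_law.
by apply: congr_lim; apply/funext => k; apply: eq_bigr => a _; rewrite in_setT mule1.
Qed.

Definition initial_degrees (l : seq nat) : set T :=
  [set x | forall i, (1 <= i <= size l)%N -> W i x = nth 0%N l i.-1].

Lemma measurable_initial l : measurable (initial_degrees l).
Proof. by apply: measurable_nat_forall => i; apply: nat_measurable_RV. Qed.

Lemma pr_initial l :
  P (initial_degrees l) = (\prod_(i <- iota 1 (size l)) P (W i @^-1` [set nth 0%N l i.-1]))%E.
Proof.
have -> : initial_degrees l = \bigcap_(i in [set` [fset i in iota 1 (size l)]%fset])
    (W i @^-1` [set nth 0%N l i.-1]).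
  apply/seteqP; split => x /= h i.
    by rewrite /= !inE mem_iota => il; apply: h; lia.
  by move=> il; apply: h; rewrite /= !inE mem_iota; lia.
rewrite indep => [|i /=|i]; last 2 first.
- by rewrite !inE mem_iota; lia.
- by [].
apply: perm_big; apply: uniq_perm => [||i].
- exact: fset_uniq.
- exact: iota_uniq.
by rewrite !inE.
Qed.

Lemma pr_initial_rcons l a :
  P (initial_degrees (rcons l a)) = (P (initial_degrees l) * (law a)%:E)%E.
Proof.
rewrite !pr_initial size_rcons -(addn1 (size l)) iotaD big_cat big_seq1 /=; congr (_ * _)%E.
  rewrite !big_seq; apply: eq_bigr => i; rewrite mem_iota => il.
  by rewrite nth_rcons; have -> : (i.-1 < size l)%N by lia.
rewrite add1n /= nth_rcons ltnn eqxx /law -prE//.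
by have := ident (i := (size l).+1) (j := 1%N); apply.
Qed.

(** Total probability over the initial degrees: conditioning on one more of them at
    a time unfolds [mean] one step at a time. *)
Lemma prob_le_mean (A : set T) (N : nat) (f : seq nat -> \bar R) :
  measurable A -> (forall l, 0 <= f l)%E ->
  (forall l, size l = N ->
     P (initial_degrees l `&` A) <= P (initial_degrees l) * f l)%E ->
  (P A <= mean law N f)%E.
Proof.
move=> mA f0 H.
suff gen n l : (size l + n = N)%N -> (P (initial_degrees l `&` A) <=
    P (initial_degrees l) * mean law n (fun s => f (l ++ s)))%E.
  have := gen N [::] (add0n N).
  have -> : initial_degrees [::] = setT.
    by apply/seteqP; split => // x _ i /=; lia.
  by rewrite setTI probability_setT mul1e.
elim: n l => [|n IH] l ln; first by rewrite /= cats0 H//; lia.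
have -> : initial_degrees l `&` A = \bigcup_a (initial_degrees (rcons l a) `&` A).
  apply/seteqP; split => [x [Hx Ax]|x [a _ [Hx Ax]]].
    exists (W (size l).+1 x) => //; split => // i; rewrite size_rcons => il.
    rewrite nth_rcons; case: ltngtP => ii.
    - by apply: Hx; lia.
    - lia.
    - by congr (W _ x); lia.
  split => // i il; have := Hx i; rewrite size_rcons nth_rcons.
  have -> : (i.-1 < size l)%N by lia.
  by apply; lia.
rewrite measure_semi_bigcup; last 3 first.
- by move=> a; apply: measurableI => //; apply: measurable_initial.
- move=> a b _ _ [x [[Ha _] [Hb _]]].
  have := Ha (size l).+1; have := Hb (size l).+1.
  rewrite !size_rcons /= !nth_rcons ltnn eqxx => -> // h; symmetry; exact: h.
- by apply: bigcup_measurable => a _; apply: measurableI => //; apply: measurable_initial.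
rewrite [X in (_ <= X * _)%E]prE; last exact: measurable_initial.
rewrite /= -mean1Z//; last 2 first.
- exact: law_ge0.
- by move=> a; apply: mean_ge0 => //; exact: law_ge0.
apply: lee_nneseries => // a _.
apply: le_trans (IH (rcons l a) _) _; first by rewrite size_rcons; lia.
rewrite pr_initial_rcons -prE; last exact: measurable_initial.
rewrite [leRHS]muleCA -muleA.
under eq_fun do rewrite cat_rcons.
by rewrite muleCA muleA.
Qed.

End Linking.

(** * Assembling the bound *)

Section Elementary.
Variable R : realType.

(** The ratio is [1 + c / (b + a)], and [b + a] is at least [1] and at least [b].
    Replacing it by their maximum makes [a], [b], [c] appear in separate factors. *)
Lemma powR_ratio_le (s a b c : R) : 0 < s <= 1 -> 1 <= a -> 0 <= b -> 0 <= c ->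
  (a * ((b + a + c) / (b + a))) `^ s <=
  a `^ s * (1 + c `^ s * Num.max 1 b `^ (- s)).
Proof.
move=> s01 a1 b0 c0; have [s0 s1] := andP s01.
have ba : 0 < b + a by lra.
have m1 : 0 < Num.max 1 b by rewrite lt_max ltr01.
have -> : (b + a + c) / (b + a) = 1 + c / (b + a) by field; rewrite gt_eqF.
have q0 : 0 <= c / (b + a) by rewrite divr_ge0// ltW.
rewrite powRM ?addr_ge0//; last by lra.
rewrite ler_wpM2l ?powR_ge0//.
apply: (le_trans (powR_le_add s01 ler01 q0)).
rewrite powR1 lerD2l powRM ?invr_ge0 ?(ltW ba)// ler_wpM2l ?powR_ge0//.
rewrite -powR_inv1 ?(ltW ba)// -powRrM mulN1r !powRN lef_pV2 ?posrE ?powR_gt0//.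
apply: ge0_ler_powR; rewrite ?nnegrE ?(ltW s0) ?(ltW m1) ?(ltW ba)//.
by rewrite ge_max; apply/andP; split; lra.
Qed.

Lemma sum_nth_take (l : seq nat) n : (n <= size l)%N ->
  (\sum_(1 <= j < n.+1) nth 0 l j.-1 = sumn (take n l))%N.
Proof.
move=> nl; rewrite sumnE big_add1 /= [RHS](big_nth 0%N) size_takel//.
by rewrite !big_nat; apply: eq_bigr => j /andP[_ jn]; rewrite nth_take.
Qed.

Lemma sum_age_le (th : R) (t : nat) : 0 <= th < 1 -> (1 <= t)%N ->
  \sum_(i < t.+1) (1 + (t%:R / (maxn i 1)%:R) `^ th) <=
  (2 + (1 - th)^-1) * t.+1%:R.
Proof.
move=> th01 t1; have [th0 th1] := andP th01.
rewrite big_split /= sumr_const card_ord big_ord_recl /=.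
have -> : maxn 0 1 = 1%N by []; rewrite divr1.
have tR : 1 <= t%:R :> R by rewrite ler1n.
have H1 : t%:R `^ th <= t%:R :> R by rewrite ler1_powR// ltW.
have H2 : \sum_(i < t) (t%:R / (maxn (lift ord0 i) 1)%:R) `^ th <= t%:R / (1 - th).
  apply: le_trans (sum_powRN_le th01 t1).
  rewrite big_add1 /= big_mkord le_eqVlt; apply/orP; left; apply/eqP.
  apply: eq_bigr => i _; congr ((_ / _%:R) `^ _).
have q0 : 0 <= (1 - th)^-1 by rewrite invr_ge0; lra.
rewrite -(natr1 t).
have : t%:R / (1 - th) <= (t%:R + 1) * (1 - th)^-1 by rewrite ler_wpM2r// lerDl.
lra.
Qed.

End Elementary.

Section InitialDegrees.
Context d (T : measurableType d) (R : realType) (P : probability T R).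
Variables (delta : R) (W : nat -> {RV P >-> nat}) (E : nat -> nat -> {RV P >-> nat}).
Variable (G : nat -> T -> multigraph).
Hypothesis M : PARID delta W E G.

Lemma expectation_prop_ge t k : (1 <= t)%N ->
  ('E_P[fun x => prop_ge R t k (G t x)] =
   ((\sum_(i < t.+1) pr P [set x | (k <= degree t (G t x) i)%N]) / t.+1%:R)%:E)%E.
Proof.
case: t => // t _; rewrite unlock.
pose A (i : nat) := [set x | (k <= degree t.+1 (G t.+1 x) i)%N].
have mA i : measurable (A i).
  exact: nat_measurable_ge (nat_measurable_degree M _ _).
have -> : (fun x => (prop_ge R t.+1 k (G t.+1 x))%:E) =
    (fun x => \sum_(i < t.+2) (t.+2%:R^-1)%:E * (\1_(A i) x)%:E)%E.
  apply/funext => x; rewrite -ge0_sume_distrr => [|i _]; last by rewrite lee_fin.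
  rewrite sumEFin -EFinM mulrC /prop_ge /num_ge natr_sum; congr (_ * _)%:E.
  apply: eq_bigr => i _; rewrite indicE; congr ((nat_of_bool _)%:R).
  by apply/idP/idP => h; [exact: mem_set|exact: set_mem h].
rewrite ge0_integral_sum//; last first.
  by move=> i; apply: measurable_funeM; apply/measurable_EFinP; exact: measurable_indic.
rewrite (eq_bigr (fun i : 'I_t.+2 => ((t.+2%:R)^-1 * pr P (A i))%:E)).
  by rewrite sumEFin -big_distrr /= mulrC.
move=> i _; rewrite ge0_integralZl//.
- by rewrite integral_indic// setIT EFinM; congr (_ * _)%E; exact: prE.
- by apply/measurable_EFinP; exact: measurable_indic.
Qed.

Lemma initial_degree_gt0 m : is_minimum (value_support (W 1%N)) m -> (0 < m)%N.
Proof.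
case=> m1 _; have [[x /= <-]|h] := pselect (W 1%N @^-1` [set m] !=set0).
  exact: parid_pos M _ _ _.
have : W 1%N @^-1` [set m] = set0 by apply/seteqP; split => // x xm; apply: h; exists x.
by move=> h0; move: m1; rewrite /value_support /= h0 measure0 ltxx.
Qed.

(** Values outside the support have probability zero. *)
Lemma initial_degrees_ge m l : is_minimum (value_support (W 1%N)) m ->
  P (initial_degrees W l) != 0%E ->
  forall i, (1 <= i <= size l)%N -> (m <= nth 0%N l i.-1)%N.
Proof.
move=> [_ mmin] Pl i il; apply: mmin; rewrite /value_support /=.
have i1 : (1 <= i)%N by lia.
have mWi j a : measurable (W j @^-1` [set a]) by exact: nat_measurable_RV.
have := parid_ident M (i := 1%N) (j := i) isT i1 (A := [set nth 0%N l i.-1]) I.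
rewrite /distribution /pushforward => ->.
have Pl0 : (0 < P (initial_degrees W l))%E by rewrite lt_neqAle eq_sym Pl measure_ge0.
apply: (lt_le_trans Pl0); apply: le_measure; rewrite ?inE//.
  exact: measurable_initial.
by move=> x /= H; exact: H.
Qed.

End InitialDegrees.

Lemma slowly_varying_gt0 (R : realType) (L : R -> R) : slowly_varying L ->
  exists x0 : R, forall x, x0 < x -> 0 < L x.
Proof. by case=> -[x0 [_ h]] _; exists x0. Qed.

(** The ratio [u (2 * x) / u x] tends to [2 `^ (- alpha)], which lies strictly
    between [2^-1] and [2 `^ (- beta)] for [beta] halfway between [s] and
    [alpha]. *)
Lemma slowly_varying_doubling (R : realType) (L u : R -> R) (alpha s : R) :
  0 < s < alpha -> alpha < 1 -> slowly_varying L ->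
  (forall x, 0 < x -> u x = x `^ (- alpha) * L x) ->
  exists x0 th q rho : R,
    [/\ 1 <= x0, 0 < th < 1 & 0 < q < 1] /\
    [/\ 2 `^ s * q < 1, 2 `^ s * q `^ th <= 1 & 2^-1 < rho < 1] /\
    (forall x, x0 <= x -> u (2 * x) <= q * u x) /\
    (forall x, x0 <= x -> u x <= 2 * rho * u (2 * x)).
Proof.
move=> /andP[s0 sa] a1 slowL uE.
have [y0 Lpos] := slowly_varying_gt0 slowL.
have two0 : (2 : R) != 0 by [].
have pow2D (a b : R) : (2 : R) `^ (a + b) = 2 `^ a * 2 `^ b.
  by rewrite powRD// two0 implybT.
have pow2_lt1 (a : R) : a < 0 -> (2 : R) `^ a < 1.
  move=> alt; have : (1 : R) `^ (- a) < 2 `^ (- a).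
    by apply: gt0_ltr_powR; rewrite ?nnegrE ?oppr_gt0// ltr1n.
  by rewrite powR1 powRN invf_gt1 ?powR_gt0.
pose beta := (s + alpha) / 2.
have sb : s < beta by rewrite /beta; lra.
have ba : beta < alpha by rewrite /beta; lra.
pose v := (2 : R) `^ (- alpha).
have v0 : 0 < v by rewrite powR_gt0.
have v2 : 2^-1 < v.
  have h : v^-1 = 2 `^ alpha by rewrite /v powRN invrK.
  rewrite -[v]invrK h ltf_pV2 ?posrE ?powR_gt0//.
  have -> : (2 : R) `^ alpha = 2 `^ 1 * 2 `^ (alpha - 1).
    by rewrite -pow2D; congr (_ `^ _); ring.
  rewrite powRr1//.
  by rewrite gtr_pMr// pow2_lt1//; lra.
have v1 : v < 1 by apply: pow2_lt1; lra.
pose q := (2 : R) `^ (- beta).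
have q0 : 0 < q by rewrite powR_gt0.
have vq : v < q.
  have -> : v = q * 2 `^ (beta - alpha) by rewrite -pow2D; congr (_ `^ _); ring.
  by rewrite gtr_pMr// pow2_lt1//; lra.
pose r := (v + 2^-1) / 2.
have r2 : 2^-1 < r by rewrite /r; lra.
have rv : r < v by rewrite /r; lra.
have r0 : 0 < r by apply: lt_trans r2; rewrite invr_gt0.
(* e is small enough for both v * (1 - e) >= r and v * (1 + e) <= q *)
pose e := Num.min (q / v - 1) (1 - r / v).
have e0 : 0 < e.
  by rewrite lt_min !subr_gt0 ltr_pdivlMr// ltr_pdivrMr// !mul1r vq.
have [_ /(_ 2 (ltr0n _ 2)) /cvgrPdist_lt /(_ e e0) [z0 [_ Hz]]] := slowL.
pose x0 := Num.max 1 (Num.max y0 z0 + 1).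
have x01 : 1 <= x0 by rewrite le_max lexx.
have key x : x0 <= x -> r * u x <= u (2 * x) <= q * u x.
  move=> xx; have x1 : 1 <= x by exact: le_trans xx.
  have yz : Num.max y0 z0 < x.
    apply: lt_le_trans xx; rewrite lt_max; apply/orP; right; lra.
  have [yx zx] : y0 < x /\ z0 < x by move: yz; rewrite gt_max => /andP.
  have Lx : 0 < L x by exact: Lpos.
  have := Hz x zx; rewrite ltr_distlC => /andP[h1 h2].
  have xp : 0 < x by lra.
  have x2 : 0 < 2 * x by lra.
  have xa : 0 < x `^ (- alpha) by rewrite powR_gt0.
  rewrite (uE _ xp) (uE _ x2) powRM//; last by lra.
  rewrite -/v; set c := L (2 * x) / L x in h1 h2.
  have -> : L (2 * x) = c * L x by rewrite /c divfK// gt_eqF.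
  have m : 0 < x `^ (- alpha) * L x by rewrite mulr_gt0.
  have -> : v * x `^ (- alpha) * (c * L x) = (v * c) * (x `^ (- alpha) * L x) by ring.
  have e1 : e <= q / v - 1 by rewrite ge_min lexx.
  have e2 : e <= 1 - r / v by rewrite ge_min lexx orbT.
  rewrite !(ler_pM2r m); apply/andP; split.
    have : r / v <= c by lra.
    by rewrite ler_pdivrMr// mulrC.
  have : c <= q / v by lra.
  by rewrite ler_pdivlMr// mulrC.
exists x0, (s / beta), q, (r^-1 / 2); split; [|split; [|split]].
- split=> //; apply/andP; split; rewrite ?divr_gt0 ?ltr_pdivrMr ?mul1r//; try lra.
  by apply: pow2_lt1; lra.
- split.
  + by rewrite /q -pow2D pow2_lt1//; lra.
  + rewrite /q -powRrM -pow2D.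
    have -> : s + - beta * (s / beta) = 0 by field; lra.
    by rewrite powRr0.
  + have ri : r^-1 * r = 1 by rewrite mulVf ?gt_eqF.
    apply/andP; split.
      by rewrite ltr_pdivlMr// mulVf// invf_gt1//; lra.
    by rewrite ltr_pdivrMr// mul1r -[ltRHS]invrK ltf_pV2 ?posrE ?invr_gt0.
- by move=> x /key /andP[].
- move=> x /key /andP[h _].
  by rewrite mulrCA mulfV// mulr1 ler_pdivlMl.
Qed.

Section DegreeTail.
Context d (T : measurableType d) (R : realType) (P : probability T R).
Variables (delta : R) (W : nat -> {RV P >-> nat}) (E : nat -> nat -> {RV P >-> nat}).
Variable (G : nat -> T -> multigraph).
Hypothesis M : PARID delta W E G.

(** The bound for given initial degrees splits into factors that depend on those
    before, at and after the birth of v_i, and is then averaged. *)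
Lemma pr_degree_ge_le (s th C : R) : 0 < s <= 1 -> 0 <= C ->
  (forall m n t : nat, (0 < t)%N -> (n <= t)%N ->
    (mean (law W) m (fun l1 => mean1 (law W) (fun w => mean (law W) n (fun l2 =>
     (w%:R `^ s * (1 + (sumn l2)%:R `^ s *
        (Num.max 1 (sumn l1)%:R) `^ (- s)))%:E)))
   <= (C * (1 + (t%:R / m.+1%:R) `^ th))%:E)%E) ->
  exists2 K : R, 0 <= K & forall t k i, (1 <= t)%N -> (1 <= k)%N -> (i <= t)%N ->
    pr P [set x | (k <= degree t (G t x) i)%N] <=
    K * (1 + (t%:R / (maxn i 1)%:R) `^ th) * k%:R `^ (- s).
Proof.
move=> s01 C0 moment; have [m0 m0min m0delta] := parid_delta M.
have m0_gt0 := initial_degree_gt0 M m0min.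
pose c := ((1 + `|delta|) / kappa delta m0) ^+ 2.
have c0 : 0 <= c by rewrite /c exprn_even_ge0.
exists (c `^ s * C); first by rewrite mulr_ge0// powR_ge0.
move=> t k i t1 k1 it.
pose j := maxn i 1; have jt : (1 <= j <= t)%N by rewrite /j; lia.
pose m := j.-1; have jm : m.+1 = j by rewrite /m; lia.
pose n := (t - j)%N; have tmn : t = (m + n.+1)%N by rewrite /n /m; lia.
set A := [set x | _].
have mA : measurable A.
  rewrite /A; case: (t) t1 => // t' _.
  exact: nat_measurable_ge (nat_measurable_degree M _ _).
pose g l1 w l2 : R := w%:R `^ s * (1 + (sumn l2)%:R `^ s *
        (Num.max 1 (sumn l1)%:R) `^ (- s)).
have g0 l1 w l2 : 0 <= g l1 w l2.
  by rewrite /g mulr_ge0 ?powR_ge0// addr_ge0// mulr_ge0 ?powR_ge0.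
pose b : R := c `^ s * k%:R `^ (- s).
have b0 : 0 <= b by rewrite mulr_ge0 ?powR_ge0.
pose f (l : seq nat) : \bar R := (b * g (take m l) (nth 0%N l m) (drop j l))%:E.
have f0 l : (0 <= f l)%E by rewrite lee_fin mulr_ge0.
have k0 : 0 < k%:R :> R by rewrite ltr0n.
have step1 : (P A <= mean (law W) t f)%E.
  apply: (prob_le_mean (parid_indep M) (parid_ident M)) => // l lt.
  have mH := measurable_initial W l.
  have [Pl|Pl] := eqVneq (P (initial_degrees W l)) 0%E.
    rewrite Pl mul0e -Pl; apply: le_measure; rewrite ?inE//.
    exact: measurableI.
  have w_ge := initial_degrees_ge M m0min Pl.
  rewrite lt in w_ge.
  have s01' : 0 <= s <= 1 by case/andP: s01 => h1 h2; rewrite ltW.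
  have D := pr_degree_ge_given M m0_gt0 m0delta w_ge t1 it k1 s01'.
  have HE : [set x | (forall i0 : nat, (0 < i0 <= t)%N -> W i0 x = nth 0%N l i0.-1)]
      = initial_degrees W l by rewrite /initial_degrees lt.
  rewrite HE -/A in D.
  rewrite !prE//; last by apply: measurableI.
  rewrite -EFinM lee_fin; apply: (le_trans D); rewrite ler_wpM2l ?pr_ge0//.
  rewrite -/c -/j /edge_count.
  rewrite (sum_nth_take (n := t)) ?lt// -lt take_size (sum_nth_take (n := j)); last by lia.
  rewrite -[in take j l]jm (take_nth 0%N); last by rewrite lt; lia.
  set a := nth 0%N l m; set l1 := take m l; set l2 := drop j l.
  have Sl : sumn l = (sumn l1 + a + sumn l2)%N.
    rewrite -{1}(cat_take_drop j l) sumn_cat -[in take j l]jm.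
    by rewrite (take_nth 0%N) ?lt -/a -/l1 ?sumn_rcons//; lia.
  rewrite sumn_rcons Sl !natrD.
  have a1 : 1 <= a%:R :> R.
    by rewrite ler1n (leq_trans m0_gt0)// /a -[m]/(m.+1.-1) jm w_ge.
  set y := _%:R * _.
  have y0 : 0 <= y.
    by rewrite /y mulr_ge0// divr_ge0// !addr_ge0.
  have ki : 0 <= k%:R^-1 :> R by rewrite invr_ge0 ltW.
  rewrite (powRM _ (mulr_ge0 c0 y0) ki) (powRM _ c0 y0).
  rewrite -(powR_inv1 (ltW k0)) -powRrM mulN1r mulrAC -/b.
  by rewrite ler_wpM2l// /g; apply: powR_ratio_le.
rewrite -lee_fin -prE//; apply: (le_trans step1).
have mom := moment m n t t1 (leq_subr _ _).
rewrite jm -/j in mom.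
rewrite tmn mean_cat /=.
apply: (@le_trans _ _ (b%:E * (C * (1 + (t%:R / j%:R) `^ th))%:E)%E); last first.
  by rewrite -EFinM lee_fin /b -tmn le_eqVlt; apply/orP; left; apply/eqP; ring.
apply: le_trans (lee_wpmul2l _ mom); last by rewrite lee_fin.
have law0 := @law_ge0 _ _ _ _ W.
rewrite -meanZ//; last first.
  by move=> l1; apply: mean1_ge0 => // w; apply: mean_ge0 => // l2; rewrite lee_fin.
apply: le_mean => // l1.
  by apply: mean1_ge0 => // w; apply: mean_ge0 => // l2.
move=> l1m; rewrite -mean1Z//; last first.
  by move=> w; apply: mean_ge0 => // l2; rewrite lee_fin.
apply: le_mean1 => // w; first by apply: mean_ge0 => // l2.
rewrite -meanZ//.
apply: le_mean => // l2 _.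
rewrite /f -EFinM lee_fin -jm take_size_cat// nth_cat l1m ltnn subnn /=.
by rewrite drop_cat l1m ltnNge leqnSn /= subSn// subnn /= drop0.
Qed.

End DegreeTail.

Lemma pr_le1 d (T : measurableType d) (R : realType) (P : probability T R) A :
  measurable A -> pr P A <= 1.
Proof. by move=> mA; rewrite -lee_fin -prE// probability_le1. Qed.

Theorem corollary1p7 (d : measure_display) (T : measurableType d)
    (R : realType) (P : probability T R) (delta : R)
    (W : nat -> {RV P >-> nat}) (E : nat -> nat -> {RV P >-> nat})
    (G : nat -> T -> multigraph) (tauW : R) (L : R -> R) :
  PARID delta W E G ->
  1 < tauW < 2 ->
  slowly_varying L ->
  (forall x : R, 0 < x ->
    P [set w | x < (W 1%N w)%:R] = (x `^ (1 - tauW) * L x)%:E) ->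
  forall s : R, s < tauW - 1 ->
  exists M : R, forall t k : nat, (1 <= t)%N -> (1 <= k)%N ->
    ('E_P[fun w => prop_ge R t k (G t w)] <= (M * k%:R `^ (- s))%:E)%E.
Proof.
move=> HM /andP[tau1 tau2] slowL tailW s s_lt.
have [s0|s0] := leP s 0.
  exists 1 => t k t1 k1; rewrite (expectation_prop_ge HM)// lee_fin mul1r.
  apply: (@le_trans _ _ 1).
    rewrite ler_pdivrMr ?ltr0n// mul1r.
    apply: (@le_trans _ _ (\sum_(i < t.+1) 1)); last by rewrite sumr_const card_ord.
    apply: ler_sum => i _; apply: pr_le1; case: t t1 i => // t _ i.
    exact: nat_measurable_ge (nat_measurable_degree HM _ _).
  have k1R : 1 <= k%:R :> R by rewrite ler1n.
  by have := @ler_powR _ _ k1R 0 (- s); rewrite powRr0; apply; rewrite oppr_ge0.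
pose u (x : R) : R := pr P [set w | x < (W 1%N w)%:R].
have mtail (x : R) : measurable [set w | x < (W 1%N w)%:R].
  exact: (@measurable_funPTI _ _ _ _ (W 1%N) [set n | x < n%:R] I).
have uE (x : R) : 0 < x -> u x = x `^ (- (tauW - 1)) * L x.
  by move=> x0; rewrite /u /pr tailW// opprB.
have tailE (x : R) : mean1 (law W) (fun a => ((x < a%:R)%R%:R)%:E) = (u x)%:E.
  rewrite -prE// -(mean1_law W [set n | x < n%:R]); congr mean1.
  apply/funext => a; congr ((nat_of_bool _)%:R)%:E.
  by apply/idP/idP => [h|/set_mem//]; exact: mem_set.
have law0 := @law_ge0 _ _ _ _ W.
have u_gt0 (x : R) : 0 < u x.
  have [y0 Lpos] := slowly_varying_gt0 slowL.
  pose y := Num.max 0 (Num.max x y0) + 1.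
  have [ym0 ymx ymy] : [/\ 0 < y, x <= y & y0 < y].
    have h0 : 0 <= Num.max 0 (Num.max x y0) by rewrite le_max lexx.
    have h1 : x <= Num.max 0 (Num.max x y0) by rewrite !le_max lexx orbT.
    have h2 : y0 <= Num.max 0 (Num.max x y0) by rewrite !le_max lexx !orbT.
    by rewrite /y; split; lra.
  apply: (lt_le_trans _ (tail_le law0 tailE ymx)).
  by rewrite uE// mulr_gt0 ?powR_gt0// Lpos.
have s0a : 0 < s < tauW - 1 by rewrite s0.
have [x0 [th [q [rho [[x01 th01 q01] [[qs qth rho01] [dle dge]]]]]]] :=
  slowly_varying_doubling s0a ltac:(lra) slowL uE.
have s01 : 0 < s < 1 by rewrite s0; lra.
have [C C0 moment] := mean_degree_moment_le law0 (sum_law W) tailE u_gt0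
  x01 s01 th01 q01 qs qth rho01 dle dge.
have s01' : 0 < s <= 1 by rewrite s0; lra.
have [K K0 HK] := pr_degree_ge_le HM s01' C0 moment.
have [th0 th1] := andP th01.
exists (K * (2 + (1 - th)^-1)) => t k t1 k1.
rewrite (expectation_prop_ge HM)// lee_fin ler_pdivrMr ?ltr0n//.
apply: (@le_trans _ _ (\sum_(i < t.+1)
    K * (1 + (t%:R / (maxn i 1)%:R) `^ th) * k%:R `^ (- s))).
  by apply: ler_sum => i _; apply: HK => //; rewrite -ltnS.
rewrite -big_distrl -big_distrr /= -!mulrA ler_wpM2l//.
rewrite mulrCA [leLHS]mulrC ler_wpM2l ?powR_ge0//.
by apply: sum_age_le => //; rewrite (ltW th0).
Qed.
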